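(* Let $(R,\mathfrak m,k)$ be a local ring with $\mathfrak m^3=0$ and $\operatorname{rank}_k\mathfrak m^2=1$. Set $e=\operatorname{rank}_k(\mathfrak m/\mathfrak m^2)$ and $s=\operatorname{rank}_k(0:\mathfrak m)$, and let $(b_n)_{n\ge0}$ be the sequence with $b_0=1$, $b_1=e$, and $b_{n+1}=e\,b_n-b_{n-1}$ for $n\ge1$. The following conditions are equivalent. (i) There is an inflation $R\to(R',\mathfrak m',k')$ such that $\mathfrak m'$ has a Conca generator. (ii) $R$ is Koszul. (iii) $P^R_k(t)\cdot(1-et+t^2)=1$. (iv) $\beta^R_n(k)=b_n$ for every integer $n\ge0$. (v) $s\le e-1$.
   Context: A local ring $(R,\mathfrak m,k)$ is a commutative Noetherian ring $R$ with unique maximal ideal $\mathfrak m$ and residue field $k=R/\mathfrak m$. $\operatorname{rank}_k$ is dimension over $k$, and $(0:\mathfrak m)$ is the annihilator of $\mathfrak m$ in $R$. Inflation: a ring homomorphism $R\to R'$ to a local ring $(R',\mathfrak m',k')$ making $R'$ a flat $R$-module with $\mathfrak m'=R'\mathfrak m$. Conca generator: an element $x$ is a Conca generator of an ideal $J$ if $x\in J$, $x\neq0=x^2$ and $xJ=J^2$. Betti numbers and Poincaré series: $\beta^R_n(M)=\operatorname{rank}_k\operatorname{Ext}^n_R(M,k)$ and $P^R_M(t)=\sum_{n\ge0}\beta^R_n(M)t^n$. Koszul: let $F$ be a minimal free resolution of a finitely generated $R$-module $M$. For each $j\ge0$ the differential and the augmentation induce a complex of $k$-vector spaces $$\operatorname{lin}_j(F)=\quad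 0\to \frac{F_j}{\mathfrak mF_j}\to\cdots\to\frac{\mathfrak m^{j-n}F_n}{\mathfrak m^{j+1-n}F_n}\to\cdots\to\frac{\mathfrak m^{j}F_0}{\mathfrak m^{j+1}F_0}\to\frac{\mathfrak m^jM}{\mathfrak m^{j+1}M}\to0;$$ $M$ is Koszul if $\operatorname{lin}_j(F)$ is acyclic for every $j\ge0$. The ring $R$ is Koszul if $k$ is a Koszul $R$-module. *)

(* Defs.v *)
From HB Require Import structures.
From mathcomp Require Import all_boot all_order all_algebra.
From mathcomp Require Import all_classical.

Set Implicit Arguments.
Unset Strict Implicit.
Unset Printing Implicit Defensive.

Import Order.TTheory GRing.Theory Num.Theory.
Local Open Scope classical_set_scope.
Local Open Scope ring_scope.

Definition submodule (R : comNzRingType) (V : lmodType R) (A : set V) : Prop :=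
  GRing.submod_closed [in A].

Definition ideal (R : comNzRingType) (J : set R) : Prop :=
  submodule (J : set R^o).

Definition ideal_span (R : comNzRingType) (G : set R) : set R :=
  smallest (@ideal R) G.

(* The submodule I A of V, i.e. all finite sums of products a *: x. *)
Definition ideal_smul (R : comNzRingType) (V : lmodType R) (I : set R)
    (A : set V) : set V :=
  smallest (@submodule R V) [set a *: x | a in I & x in A].

Definition ideal_pow (R : comNzRingType) (I : set R) (n : nat) : set R :=
  iter n (fun J : set R => ideal_smul I (J : set R^o)) setT.

Definition annihilator (R : comNzRingType) (I : set R) : set R :=
  [set x | forall a, I a -> a * x = 0].

Definition noetherian (R : comNzRingType) : Prop :=
  forall J : set R, ideal J ->
    exists (n : nat) (g : 'I_n -> R), J = ideal_span (range g).

Definition maximal_ideal (R : comNzRingType) (J : set R) : Prop :=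
  [/\ ideal J, J <> setT &
      forall I : set R, ideal I -> J `<=` I -> I = J \/ I = setT].

(* The residue field R/m is given as a field k together with a surjective ring
   morphism pi : R -> k of kernel m. *)
Definition local_ring (R : comNzRingType) (m : set R) (k : fieldType)
    (pi : {rmorphism R -> k}) : Prop :=
  [/\ noetherian R,
      maximal_ideal m,
      (forall J : set R, maximal_ideal J -> J = m),
      range pi = setT &
      [set x | pi x = 0] = m].

Definition conca_generator (R : comNzRingType) (J : set R) (x : R) : Prop :=
  [/\ J x, x != 0, x ^+ 2 = 0 & [set x * y | y in J] = ideal_pow J 2].

(* S viewed as an R-module through phi : R -> S. *)
Definition restr (R S : comNzRingType) (phi : {rmorphism R -> S}) : Type := S.

Section Restr.
Variables (R S : comNzRingType) (phi : {rmorphism R -> S}).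

HB.instance Definition _ := GRing.Zmodule.on (restr phi).

Let scale (a : R) (x : restr phi) : restr phi := phi a * (x : S).

Fact restr_scalerA a b x : scale a (scale b x) = scale (a * b) x.
Proof. by rewrite /scale rmorphM mulrA. Qed.

Fact restr_scale1r : left_id 1 scale.
Proof. by move=> x; rewrite /scale rmorph1 mul1r. Qed.

Fact restr_scalerDr : right_distributive scale +%R.
Proof. by move=> a x y; rewrite /scale mulrDr. Qed.

Fact restr_scalerDl x : {morph scale^~ x : a b / a + b}.
Proof. by move=> a b; rewrite /scale rmorphD mulrDl. Qed.

HB.instance Definition _ := GRing.Zmodule_isLmodule.Build R (restr phi)
  restr_scalerA restr_scale1r restr_scalerDr restr_scalerDl.

End Restr.

Definition bilinear_map (R : comNzRingType) (M N P : lmodType R)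
    (B : M -> N -> P) : Prop :=
  (forall x : M, linear (B x)) /\ (forall y : N, linear (B^~ y)).

(* The element \sum_(p <- s) p.1 (x) p.2 of the tensor product of M and N is 0:
   by the universal property, this means that every bilinear map kills it. *)
Definition tensor_eq0 (R : comNzRingType) (M N : lmodType R)
    (s : seq (M * N)) : Prop :=
  forall (P : lmodType R) (B : M -> N -> P), bilinear_map B ->
    \sum_(p <- s) B p.1 p.2 = 0.

(* Tensoring with M preserves injectivity of linear maps. *)
Definition flat (R : comNzRingType) (M : lmodType R) : Prop :=
  forall (N N' : lmodType R) (f : {linear N -> N'}), injective f ->
    forall s : seq (M * N),
      tensor_eq0 [seq (p.1, f p.2) | p <- s] -> tensor_eq0 s.

Definition inflation (R : comNzRingType) (m : set R) (R' : comNzRingType)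
    (m' : set R') (phi : {rmorphism R -> R'}) : Prop :=
  flat (restr phi) /\ m' = ideal_span (phi @` m).

(* For submodules B `<=` A of V with m A `<=` B, the quotient A / B is a vector
   space over k = R / m; v induces a k-basis of it. *)
Definition subquo_basis (R : comNzRingType) (k : fieldType)
    (pi : {rmorphism R -> k}) (V : lmodType R) (A B : set V)
    (n : nat) (v : 'I_n -> V) : Prop :=
  [/\ forall i, A (v i),
      forall x, A x -> exists c : 'I_n -> R, B (x - \sum_i c i *: v i) &
      forall c : 'I_n -> R, B (\sum_i c i *: v i) -> forall i, pi (c i) = 0].

(* rank_k (A / B); the value is 0 by convention if no finite basis exists. *)
Definition rank (R : comNzRingType) (k : fieldType) (pi : {rmorphism R -> k})
    (V : lmodType R) (A B : set V) : nat :=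
  xget 0%N [set n | exists v : 'I_n -> V, subquo_basis pi A B v].

Record free_resolution (R : comNzRingType) (M : lmodType R) :=
  FreeResolution {
    fr_rank : nat -> nat;
    fr_diff : forall n,
      {linear 'rV[R]_(fr_rank n.+1) -> 'rV[R]_(fr_rank n)};
    fr_aug : {linear 'rV[R]_(fr_rank 0%N) -> M};
    fr_aug_surj : range fr_aug = setT;
    fr_exact0 : [set x | fr_aug x = 0] = range (fr_diff 0%N);
    fr_exactS : forall n, [set x | fr_diff n x = 0] = range (fr_diff n.+1)
  }.

Definition fr_mod (R : comNzRingType) (M : lmodType R)
    (F : free_resolution M) (n : nat) : lmodType R := 'rV[R]_(fr_rank F n).

Definition minimal_resolution (R : comNzRingType) (m : set R)
    (M : lmodType R) (F : free_resolution M) : Prop :=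
  forall n, range (fr_diff F n) `<=` ideal_smul m [set: fr_mod F n].

(* The module of all maps F_n -> N; its linear elements form Hom_R(F_n, N). *)
Definition fr_maps (R : comNzRingType) (M : lmodType R)
    (F : free_resolution M) (N : lmodType R) (n : nat) : lmodType R :=
  fr_mod F n -> N.

(* Ext^n_R(M, N) is cocycles / coboundaries of the complex Hom_R(F, N). *)
Definition ext_cocycles (R : comNzRingType) (M : lmodType R)
    (F : free_resolution M) (N : lmodType R) (n : nat) :
    set (fr_maps F N n) :=
  [set f : fr_mod F n -> N | linear f /\ forall x, f (fr_diff F n x) = 0].

Definition ext_coboundaries (R : comNzRingType) (M : lmodType R)
    (F : free_resolution M) (N : lmodType R) (n : nat) :
    set (fr_maps F N n) :=
  match n with
  | 0 => [set 0]
  | n'.+1 => [set f : fr_mod F n'.+1 -> N | exists2 g : fr_mod F n' -> N,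
                linear g & forall x, f x = g (fr_diff F n' x)]
  end.

Arguments ext_cocycles {R M} F N n _.
Arguments ext_coboundaries {R M} F N n _.

(* rank_k Ext^n_R(M, k), which does not depend on the resolution. *)
Definition betti (R : comNzRingType) (k : fieldType) (pi : {rmorphism R -> k})
    (M : lmodType R) (n : nat) : nat :=
  xget 0%N [set b | exists F : free_resolution M,
    b = rank pi (ext_cocycles F (restr pi) n)
      (ext_coboundaries F (restr pi) n)].

(* Formal power series are given by their sequences of coefficients. *)
Definition fps_mul (A : comNzRingType) (f g : nat -> A) : nat -> A :=
  fun n => \sum_(i < n.+1) f i * g (n - i)%N.

Definition fps_of_poly (A : comNzRingType) (p : {poly A}) : nat -> A :=
  fun n => p`_n.

Definition poincare (R : comNzRingType) (k : fieldType)
    (pi : {rmorphism R -> k}) (M : lmodType R) : nat -> int :=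
  fun n => (betti pi M n)%:Z.

Definition mpow (R : comNzRingType) (m : set R) (V : lmodType R) (i : nat) :
    set V :=
  ideal_smul (ideal_pow m i) setT.

(* Exactness at A / B of the maps A' / B' -> A / B -> C / D induced by f and g
   (B' and C play no role, as f and g are assumed to induce such maps). *)
Definition subquo_exact (R : comNzRingType) (U V W : lmodType R)
    (f : U -> V) (g : V -> W) (A' : set U) (A B : set V) (D : set W) : Prop :=
  [set x | A x /\ D (g x)] = [set x | A x /\ exists2 y, A' y & B (x - f y)].

(* For n > j, truncated subtraction turns m^(j-n) F_n / m^(j+1-n) F_n into
   F_n / F_n = 0, as wanted in lin_j(F). *)
Definition lin_acyclic (R : comNzRingType) (m : set R) (M : lmodType R)
    (F : free_resolution M) (j : nat) : Prop :=
  [/\ subquo_exact (fr_aug F : fr_mod F 0 -> M) (fun=> 0 : M)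
        (mpow m j) (mpow m j) (mpow m j.+1) [set 0],
      subquo_exact (fr_diff F 0 : fr_mod F 1 -> fr_mod F 0) (fr_aug F)
        (mpow m (j - 1)) (mpow m j) (mpow m j.+1) (mpow m j.+1) &
      forall n,
        subquo_exact (fr_diff F n.+1 : fr_mod F n.+2 -> fr_mod F n.+1)
          (fr_diff F n : fr_mod F n.+1 -> fr_mod F n)
          (mpow m (j - n.+2)) (mpow m (j - n.+1)) (mpow m (j.+1 - n.+1))
          (mpow m (j.+1 - n))].

Definition koszul_module (R : comNzRingType) (m : set R) (M : lmodType R) :
    Prop :=
  exists F : free_resolution M,
    minimal_resolution m F /\ forall j, lin_acyclic m F j.

Definition koszul_ring (R : comNzRingType) (m : set R) (k : fieldType)
    (pi : {rmorphism R -> k}) : Prop :=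
  koszul_module m (restr pi).

(* Main.v *)
(* Let w generate m^2. The product induces a symmetric bilinear form on m/m^2 with
   values in m^2, whose radical is (0:m)/m^2, so that e - s is its rank minus one and
   (v) says that this rank is at least 2.

   In that case, either there are y, u in m with y^2 = 0 and y u = w (and y is a Conca
   generator), or there are x, y in m with x^2 <> 0, x y = 0 and y^2 = c x^2 for a unit
   c; then z = T x + y is a Conca generator over R[T]/(T^2 + c), which is an inflation
   of R when -c is not a square modulo m, and otherwise R already contains a Conca
   generator.
   A Conca generator z gives z Om = m^2 F for all the syzygies Om <= m F in the minimal
   resolution of k: if m^2 F' = w F' with w = z u, and d : F' -> Om is the minimal
   cover, then for f in F' one has u d(f) = z d(g), so that u f - z g is in the next
   syzygy, and z (u f - z g) = w f. Hence m Om = m^2 F, which makes the resolution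
   linear and gives the recurrence of the Betti numbers by counting ranks. Written on
   pairs (u, v) standing for u + T v, the argument needs no extension of R.

   If the rank of the form is 1, then m = R x + (0:m) with x^2 <> 0. No inflation of R
   has a Conca generator, and m^2 F_1 is not contained in m times the second syzygy of
   k, which contradicts both linearity and b_2 = e^2 - 1. *)
Require Import Defs.
From HB Require Import structures.
From mathcomp Require Import all_boot all_order all_algebra.
From mathcomp Require Import all_classical.
From mathcomp Require Import ring zify.

Set Implicit Arguments.
Unset Strict Implicit.
Unset Printing Implicit Defensive.

Import Order.TTheory GRing.Theory Num.Theory.
Local Open Scope classical_set_scope.
Local Open Scope ring_scope.

(** * Submodules and ideals *)

Section Submodules.
Variables (R : comNzRingType) (V : lmodType R).
Implicit Types (A B : set V) (I : set R).

Lemma submoduleP A :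
  submodule A <-> A 0 /\ forall a u v, A u -> A v -> A (a *: u + v).
Proof.
split=> [[A0 AL]|[A0 AL]]; split.
- by move: A0; rewrite inE.
- by move=> a u v Au Av; move: (AL a u v); rewrite !inE; apply.
- by rewrite inE.
- by move=> a u v; rewrite !inE; apply: AL.
Qed.

Lemma submod0 A : submodule A -> A 0.
Proof. by case/submoduleP. Qed.

Lemma submodD A x y : submodule A -> A x -> A y -> A (x + y).
Proof. by case/submoduleP=> _ h Ax Ay; rewrite -[x]scale1r; apply: h. Qed.

Lemma submodZ A a x : submodule A -> A x -> A (a *: x).
Proof.
by case/submoduleP=> A0 h Ax; rewrite -[_ *: _]addr0; apply: h.
Qed.

Lemma submodB A x y : submodule A -> A x -> A y -> A (x - y).
Proof.
by move=> sA Ax Ay; apply: submodD => //; rewrite -scaleN1r; apply: submodZ.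
Qed.

Lemma submodN A x : submodule A -> A x -> A (- x).
Proof. by move=> sA Ax; rewrite -scaleN1r; apply: submodZ. Qed.

Lemma submod_sum A (T : finType) (f : T -> V) :
  submodule A -> (forall i, A (f i)) -> A (\sum_i f i).
Proof.
move=> sA Af; apply: (big_ind A) => //; first exact: submod0.
by move=> *; apply: submodD.
Qed.

Lemma submod_comb A (T : finType) (c : T -> R) (f : T -> V) :
  submodule A -> (forall i, A (f i)) -> A (\sum_i c i *: f i).
Proof. by move=> sA Af; apply: submod_sum => // i; apply: submodZ. Qed.

Lemma submodule_set0 : submodule [set 0 : V].
Proof. by apply/submoduleP; split=> // a u v /= -> ->; rewrite scaler0 addr0. Qed.

Lemma submoduleT : submodule [set: V].
Proof. exact/submoduleP. Qed.

Lemma smallest_submodule (G : set V) : submodule (smallest (@submodule R V) G).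
Proof.
apply/submoduleP; split=> [B [sB _]|a u v Su Sv B [sB GB]]; first exact: submod0.
by apply: submodD => //; [apply: submodZ => //; apply: Su | apply: Sv].
Qed.

Lemma submodule_smul I A : submodule (ideal_smul I A).
Proof. exact: smallest_submodule. Qed.

Lemma mem_smul I A a x : I a -> A x -> ideal_smul I A (a *: x).
Proof. by move=> Ia Ax; apply: sub_gen_smallest; exists a => //; exists x. Qed.

Lemma smul_sub I A B : submodule B ->
  (forall a x, I a -> A x -> B (a *: x)) -> ideal_smul I A `<=` B.
Proof.
move=> sB h; apply: smallest_sub => //.
by move=> _ [a Ia [x Ax <-]]; apply: h.
Qed.

Lemma smul_subl I A : submodule A -> ideal_smul I A `<=` A.
Proof. by move=> sA; apply: smul_sub => // a x _; apply: submodZ. Qed.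

End Submodules.

Lemma submodule_image (R : comNzRingType) (U V : lmodType R) (f : {linear U -> V})
  (A : set U) : submodule A -> submodule (f @` A).
Proof.
move=> sA; apply/submoduleP; split.
  by exists 0; [exact: submod0|rewrite linear0].
move=> a _ _ [u Au <-] [v Av <-]; exists (a *: u + v).
  by apply: submodD => //; apply: submodZ.
by rewrite linearP.
Qed.

Lemma submodule_ker (R : comNzRingType) (U V : lmodType R) (f : {linear U -> V}) :
  submodule [set x | f x = 0].
Proof.
apply/submoduleP; split=> [|a u v /= fu fv]; first by rewrite /= linear0.
by rewrite linearP fu fv scaler0 addr0.
Qed.

Section Ideals.
Variables (R : comNzRingType).
Implicit Types (I J : set R).

Lemma idealP J : ideal J <-> J 0 /\ forall a u v, J u -> J v -> J (a * u + v).
Proof. exact: (@submoduleP R R^o J). Qed.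

Lemma ideal0 J : ideal J -> J 0.
Proof. exact: (@submod0 R R^o). Qed.

Lemma idealD J x y : ideal J -> J x -> J y -> J (x + y).
Proof. exact: (@submodD R R^o). Qed.

Lemma idealB J x y : ideal J -> J x -> J y -> J (x - y).
Proof. exact: (@submodB R R^o). Qed.

Lemma ideal_mull J a x : ideal J -> J x -> J (a * x).
Proof. exact: (@submodZ R R^o). Qed.

Lemma ideal_mulr J a x : ideal J -> J x -> J (x * a).
Proof. by rewrite mulrC; apply: ideal_mull. Qed.

Lemma ideal_comb J (T : finType) (c : T -> R) (f : T -> R) :
  ideal J -> (forall i, J (f i)) -> J (\sum_i c i * f i).
Proof. exact: (@submod_comb R R^o). Qed.

Lemma ideal_spanP (G : set R) : ideal (ideal_span G).
Proof. exact: (@smallest_submodule R R^o). Qed.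

Lemma ideal_span_sub (G J : set R) : ideal J -> G `<=` J -> ideal_span G `<=` J.
Proof. exact: smallest_sub. Qed.

Lemma ideal_span_range (T : finType) (g : T -> R) :
  ideal_span (range g) = [set \sum_i c i * g i | c in [set: T -> R]].
Proof.
apply/seteqP; split; last first.
  move=> _ [c _ <-]; apply: ideal_comb; first exact: ideal_spanP.
  by move=> i; apply: sub_gen_smallest; exists i.
apply: ideal_span_sub.
  apply/idealP; split.
    by exists (fun=> 0) => //; rewrite big1 // => i _; rewrite mul0r.
  move=> a _ _ [c _ <-] [d _ <-]; exists (fun i => a * c i + d i) => //.
  by rewrite mulr_sumr -big_split; apply: eq_bigr => i _ /=; rewrite mulrDl mulrA.
move=> _ [i _ <-]; exists (fun j => (j == i)%:R) => //.
rewrite (bigD1 i) //= eqxx mul1r big1 ?addr0 // => j /negbTE->.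
by rewrite mul0r.
Qed.

Lemma ideal_powP I n : ideal (ideal_pow I n).
Proof. by case: n => [|n]; [exact: (@submoduleT R R^o)|exact: submodule_smul]. Qed.

Lemma mem_ideal_powS I n a x : I a -> ideal_pow I n x -> ideal_pow I n.+1 (a * x).
Proof. by move=> Ia px; exact: (@mem_smul R R^o I (ideal_pow I n) a x Ia px). Qed.

Lemma ideal_powS_sub I n J : ideal J ->
  (forall a x, I a -> ideal_pow I n x -> J (a * x)) -> ideal_pow I n.+1 `<=` J.
Proof. by move=> iJ h; exact: (@smul_sub R R^o I (ideal_pow I n) J iJ h). Qed.

Lemma ideal_pow_decr I n : ideal_pow I n.+1 `<=` ideal_pow I n.
Proof. exact: (@smul_subl R R^o I _ (ideal_powP I n)). Qed.

Lemma ideal_pow1 I : ideal I -> ideal_pow I 1 = I.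
Proof.
move=> iI; apply/seteqP; split.
  by apply: ideal_powS_sub => // a x Ia _; apply: ideal_mulr.
by move=> a Ia; rewrite -[a]mulr1; apply: mem_ideal_powS.
Qed.

Lemma ideal_pow2_sub I J : ideal I -> ideal J ->
  (forall a b, I a -> I b -> J (a * b)) -> ideal_pow I 2 `<=` J.
Proof.
move=> iI iJ h; apply: ideal_powS_sub => // a x Ia.
by rewrite ideal_pow1 //; apply: h.
Qed.

Lemma mem_ideal_pow2 I a b : ideal I -> I a -> I b -> ideal_pow I 2 (a * b).
Proof. by move=> iI Ia Ib; apply: mem_ideal_powS => //; rewrite ideal_pow1. Qed.

Lemma annihilatorP I : ideal (annihilator I).
Proof.
apply/idealP; split=> [a _|r u v hu hv a Ia]; first by rewrite mulr0.
by rewrite mulrDr mulrCA hu // hv // mulr0 addr0.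
Qed.

End Ideals.

(** * Submodules of free modules cut out entry by entry *)

Section Coordinatewise.
Variables (R : comNzRingType).

(** For an ideal [I] this is [I R^n], by [smul_cwise]; the form on entries turns membership into
    conditions in [R]. *)
Definition cwise (I : set R) n : set 'rV[R]_n := [set x | forall j, I (x 0 j)].

Lemma cwise_submodule (I : set R) n : ideal I -> submodule (cwise I (n:=n)).
Proof.
move=> iI; apply/submoduleP; split=> [j|a u v hu hv j]; rewrite !mxE.
  exact: ideal0.
by apply: idealD => //; apply: ideal_mull.
Qed.

Lemma rV_basisE n (x : 'rV[R]_n) : x = \sum_j x 0 j *: delta_mx 0 j.
Proof. exact: row_sum_delta. Qed.

Lemma smul_cwise (I : set R) n : ideal I ->
  ideal_smul I [set: 'rV[R]_n] = cwise I (n:=n).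
Proof.
move=> iI; apply/seteqP; split.
  apply: smul_sub; first exact: cwise_submodule.
  by move=> a x Ia _ j; rewrite mxE; apply: ideal_mulr.
move=> x Ix; rewrite (rV_basisE x).
by apply: submod_sum => [|i]; [exact: submodule_smul | apply: mem_smul].
Qed.

Lemma mpow_cwise (m : set R) n i :
  mpow m i = cwise (ideal_pow m i) (n:=n) :> set 'rV[R]_n.
Proof. by apply: smul_cwise; apply: ideal_powP. Qed.

Lemma cwise_linear (I : set R) n p (f : {linear 'rV[R]_n -> 'rV[R]_p}) x :
  ideal I -> cwise I x -> cwise I (f x).
Proof.
move=> iI Ix; rewrite (rV_basisE x) linear_sum /=.
apply: submod_sum => [|i]; first exact: cwise_submodule.
by rewrite linearZ => j; rewrite mxE; apply: ideal_mulr.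
Qed.

End Coordinatewise.

(** * Bases of subquotients *)

Section Bases.
Variables (R : comNzRingType) (k : fieldType) (pi : {rmorphism R -> k}).

(** [subquo_basis] with an arbitrary finite index type, so that bases can be joined over sum types
    and multiplied over product types without reindexing. *)
Definition fbasis (V : lmodType R) (A B : set V) (T : finType) (v : T -> V) :=
  [/\ forall i, A (v i),
      forall x, A x -> exists c : T -> R, B (x - \sum_i c i *: v i) &
      forall c : T -> R, B (\sum_i c i *: v i) -> forall i, pi (c i) = 0].

Lemma fbasis_subquo (V : lmodType R) (A B : set V) (T : finType) (v : T -> V) :
  fbasis A B v -> subquo_basis pi A B (v \o (@enum_val T predT)).
Proof.
have sumE (c : T -> R) : \sum_i c i *: v i =
    \sum_(i < #|T|) c (enum_val i) *: v (enum_val i).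
  rewrite (reindex (@enum_val T predT)) //=.
  by apply: onW_bij; apply: enum_val_bij.
case=> vA vB vC; split=> [i|x Ax|c Bc i] /=; first exact: vA.
  have [c Bc] := vB _ Ax; exists (c \o (@enum_val T predT)).
  by rewrite -(sumE c).
have := vC (c \o @enum_rank T); rewrite sumE.
have -> : \sum_(i0 < #|T|) (c \o enum_rank) (enum_val i0) *: v (enum_val i0)
  = \sum_i0 c i0 *: (v \o enum_val) i0.
  by apply: eq_bigr => j _ /=; rewrite enum_valK.
by move=> /(_ Bc (enum_val i)) /=; rewrite enum_valK.
Qed.

Hypothesis pi_surj : forall c, exists a, pi a = c.
Hypothesis pi_unit : forall c, pi c != 0 -> exists c', c' * c = 1.

(** If [S] were larger than [T], the residue matrix expressing [w] through [v] would have a nonzero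
    vector in its left kernel. Lifted to [R], it is a relation among the [w] modulo [B] with a
    coefficient of nonzero residue. *)
Lemma fbasis_le (V : lmodType R) (A B : set V) (T S : finType)
    (v : T -> V) (w : S -> V) : submodule B ->
  (forall a x, pi a = 0 -> A x -> B (a *: x)) ->
  fbasis A B v -> fbasis A B w -> (#|S| <= #|T|)%N.
Proof.
move=> sB mA [vA vB _] [wA _ wC].
have /choice[M MP] : forall j, exists c : T -> R, B (w j - \sum_i c i *: v i).
  by move=> j; apply: vB.
rewrite leqNgt; apply/negP => ltTS.
pose N : 'M[k]_(#|S|, #|T|) := \matrix_(j, i) pi (M (enum_val j) (enum_val i)).
have : kermx N != 0.
  rewrite kermx_eq0 /row_free; apply/eqP => e.
  by have := rank_leq_col N; rewrite e leqNgt ltTS.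
move=> /matrix0Pn[l [j0 nz]].
have uN : row l (kermx N) *m N = 0 by apply: sub_kermxP; apply: row_sub.
have /choice[c cP] : forall j, exists a, pi a = row l (kermx N) 0 j.
  by move=> j; apply: pi_surj.
have Bc : B (\sum_j c (enum_rank j) *: w j).
  have -> : \sum_j c (enum_rank j) *: w j =
    \sum_j c (enum_rank j) *: (w j - \sum_i M j i *: v i) +
    \sum_i (\sum_j c (enum_rank j) * M j i) *: v i.
    under [X in _ + X]eq_bigr do rewrite scaler_suml.
    rewrite exchange_big /= -big_split; apply: eq_bigr => j _ /=.
    rewrite scalerBr scaler_sumr.
    under [X in _ + X]eq_bigr do rewrite -scalerA.
    by rewrite subrK.
  apply: submodD => //; first by apply: submod_comb.
  apply: submod_sum => // i; apply: mA => //.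
  have := congr1 (fun x : 'rV_#|T| => x 0 (enum_rank i)) uN.
  rewrite !mxE rmorph_sum (reindex (@enum_rank S)) /=; last first.
    by apply: onW_bij; apply: enum_rank_bij.
  move=> e; apply: etrans e; apply: eq_bigr => j _.
  by rewrite rmorphM cP !mxE !enum_rankK.
have := wC (fun j => c (enum_rank j)) Bc (enum_val j0); rewrite enum_valK cP mxE.
exact/eqP.
Qed.

Lemma fbasis_card (V : lmodType R) (A B : set V) (T S : finType)
    (v : T -> V) (w : S -> V) : submodule B ->
  (forall a x, pi a = 0 -> A x -> B (a *: x)) ->
  fbasis A B v -> fbasis A B w -> #|S| = #|T|.
Proof.
move=> sB mA bv bw; apply/eqP.
by rewrite eqn_leq (fbasis_le sB mA bv bw) (fbasis_le sB mA bw bv).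
Qed.

Lemma rank_fbasis (V : lmodType R) (A B : set V) (T : finType)
    (v : T -> V) : submodule B ->
  (forall a x, pi a = 0 -> A x -> B (a *: x)) ->
  fbasis A B v -> rank pi A B = #|T|.
Proof.
move=> sB mA bv; apply: xget_unique.
  by exists (v \o (@enum_val T predT)); apply: fbasis_subquo.
by move=> n [w bw]; rewrite -(fbasis_card sB mA bv bw) card_ord.
Qed.

Lemma fbasis_exists (V : lmodType R) (A B : set V) (n : nat) (g : 'I_n -> V) :
  submodule B -> (forall i, A (g i)) ->
  (forall x, A x -> exists c : 'I_n -> R, B (x - \sum_i c i *: g i)) ->
  exists (p : nat) (v : 'I_p -> V), fbasis A B v.
Proof.
move=> sB; elim: n g => [|n IH] g Ag gen.
  by exists 0%N, g; split=> // c _ [].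
have [ind|] := pselect (forall c : 'I_n.+1 -> R,
  B (\sum_i c i *: g i) -> forall i, pi (c i) = 0).
  by exists n.+1, g.
move=> /existsNP[c /not_implyP[Bc /existsNP[j /eqP/pi_unit[a aj]]]].
apply: (IH (g \o lift j)) => [i|x Ax]; first exact: Ag.
have [d dP] := gen _ Ax.
(* Adding [d j * a] times the relation cancels the coefficient of [g j], because [a * c j = 1]. *)
exists (fun i => d (lift j i) - d j * a * c (lift j i)).
have -> : x - \sum_i (d (lift j i) - d j * a * c (lift j i)) *: (g \o lift j) i
  = x - \sum_i d i *: g i + (d j * a) *: \sum_i c i *: g i.
  rewrite ![\sum_(i < n.+1) _](bigD1_ord j) //= scalerDr scalerA.
  rewrite -[_ * a * c j]mulrA aj mulr1 scaler_sumr.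
  rewrite [\sum_(i < n) (_ - _) *: _](eq_bigr (fun i => d (lift j i) *: g (lift j i)
      - d j * a * c (lift j i) *: g (lift j i))); last first.
    by move=> i _; rewrite scalerBl.
  rewrite sumrB.
  under [X in _ = _ + (_ + X)]eq_bigr do rewrite scalerA.
  rewrite opprB -addrA; congr (_ + _).
  by rewrite [in RHS]opprD addrACA addNr add0r addrC.
by apply: submodD => //; apply: submodZ.
Qed.

(** Additivity of rank. A relation modulo [C] is one modulo [B], so its coefficients on [v] lie in
    the kernel of [pi]; these send [A] into [C], so the [v] part drops out and a relation among the
    [w] remains. *)
Lemma fbasis_cat (V : lmodType R) (A B C : set V) (T S : finType)
    (v : T -> V) (w : S -> V) :
  submodule B -> submodule C -> B `<=` A -> C `<=` B ->
  (forall a x, pi a = 0 -> A x -> C (a *: x)) ->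
  fbasis A B v -> fbasis B C w ->
  fbasis A C (fun i : T + S => match i with inl t => v t | inr s => w s end).
Proof.
move=> sB sC BA CB mA [vA vB vC] [wB wC wD]; split=> [[i|i]|x Ax|c].
- exact: vA.
- exact/BA/wB.
- have [c Bc] := vB _ Ax; have [d Cd] := wC _ Bc.
  exists (fun i => match i with inl t => c t | inr s => d s end).
  by rewrite big_sumType /= opprD addrA.
rewrite big_sumType /= => Cc.
have pv : forall i, pi (c (inl i)) = 0.
  apply: (vC (fun i => c (inl i))).
  have Bw : B (\sum_i c (inr i) *: w i) by apply: submod_comb.
  rewrite -[X in B X](addrK (\sum_i c (inr i) *: w i)).
  by apply: submodB => //; apply: CB.
case=> [//|j].
apply: (wD (fun j => c (inr j))).
rewrite -[X in C X](addKr (\sum_i c (inl i) *: v i)); apply: submodD => //.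
by apply: submodN => //; apply: submod_sum => // i; apply: mA.
Qed.

(** The two equalities make the map of quotients induced by [f] onto and injective, so it carries
    bases to bases. *)
Lemma fbasis_img (U V : lmodType R) (f : {linear U -> V}) (A' B' : set U)
    (A B : set V) (T : finType) (u : T -> U) :
  A = f @` A' -> B' = [set x | A' x /\ B (f x)] -> submodule A' ->
  fbasis A' B' u -> fbasis A B (f \o u).
Proof.
move=> -> -> sA [uA uB uC].
have fE c : \sum_i c i *: (f \o u) i = f (\sum_i c i *: u i).
  by rewrite linear_sum; apply: eq_bigr => i _; rewrite linearZ.
split=> [i|_ [x Ax <-]|c Bc]; first by exists (u i).
  have [c [_ Bc]] := uB _ Ax; exists c.
  by rewrite fE -linearB.
by apply: uC; split; [apply: submod_comb | rewrite -fE].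
Qed.

Lemma fbasis_cwise (I J : set R) n (T : finType) (v : T -> R) :
  ideal I -> ideal J ->
  fbasis (V := R^o) I J v ->
  fbasis (cwise I (n:=n)) (cwise J (n:=n))
    (fun p : T * 'I_n => v p.1 *: delta_mx 0 p.2).
Proof.
move=> iI iJ [vI vJ vC].
have sE (c : T * 'I_n -> R) j :
    (\sum_p c p *: (v p.1 *: delta_mx 0 p.2 : 'rV[R]_n)) 0 j =
    \sum_t c (t, j) *: (v t : R^o).
  pose F t i := (c (t, i) *: (v t *: delta_mx 0 i : 'rV[R]_n)) 0 j.
  rewrite summxE (eq_bigr (fun p => F p.1 p.2)) => [|[t i] _ //].
  rewrite -(pair_bigA _ F) /F /=.
  apply: eq_bigr => t _; rewrite (bigD1 j) //= big1 ?addr0; last first.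
    by move=> i ne; rewrite !mxE eqxx eq_sym (negbTE ne) !mulr0.
  by rewrite !mxE !eqxx mulr1.
split=> [[t i] j|x Ix|c Jc].
- by rewrite mxE; apply: ideal_mulr.
- have /choice[c cP] : forall j, exists c : T -> R,
    J (x 0 j - \sum_i c i *: (v i : R^o)) by move=> j; apply: vJ.
  exists (fun p => c p.2 p.1) => j.
  by rewrite mxE [X in _ + X]mxE sE.
by case=> t j; apply: (vC (fun t => c (t, j))); rewrite -sE.
Qed.

End Bases.

(** * Minimal resolutions *)

Section Comb.
Variables (R : comNzRingType) (V : lmodType R) (n : nat) (g : 'I_n -> V).

Definition comb (x : 'rV[R]_n) : V := \sum_i x 0 i *: g i.

Fact comb_is_linear : linear comb.
Proof.
move=> a x y; rewrite /comb scaler_sumr -big_split; apply: eq_bigr => i _ /=.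
by rewrite !mxE scalerDl scalerA.
Qed.

HB.instance Definition _ :=
  GRing.isLinear.Build R 'rV[R]_n V _ comb comb_is_linear.

Lemma comb_row (c : 'I_n -> R) : comb (\row_i c i) = \sum_i c i *: g i.
Proof. by apply: eq_bigr => i _; rewrite mxE. Qed.

End Comb.

(** Projectivity of finite free modules: preimages are chosen for the images of the unit vectors. *)
Lemma linear_lift (R : comNzRingType) (V W : lmodType R) n
    (f : {linear 'rV[R]_n -> V}) (p : {linear W -> V}) :
  (forall x, range p (f x)) ->
  exists h : {linear 'rV[R]_n -> W}, forall x, p (h x) = f x.
Proof.
move=> fp; have /choice[g gP] : forall i, exists y, p y = f (delta_mx 0 i).
  by move=> i; have [y _ <-] := fp (delta_mx 0 i); exists y.
exists (comb g) => x; rewrite {2}(rV_basisE x) !linear_sum.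
by apply: eq_bigr => i _; rewrite !linearZ /= gP.
Qed.

(** Induction on the number [i] of coordinates allowed to be nonzero. The last such coordinates form
    an ideal [J]; lifts of its generators, together with generators of the elements where that
    coordinate vanishes, generate [A]. *)
Lemma noetherian_rV (R : comNzRingType) n (A : set 'rV[R]_n) :
  noetherian R -> submodule A ->
  exists (p : nat) (g : 'I_p -> 'rV[R]_n),
    (forall i, A (g i)) /\ forall x, A x -> exists c, x = \sum_i c i *: g i.
Proof.
move=> noeth sA.
suff H i : (i <= n)%N -> forall A : set 'rV[R]_n, submodule A ->
    (forall x, A x -> forall j : 'I_n, (i <= j)%N -> x 0 j = 0) ->
    exists (T : finType) (g : T -> 'rV[R]_n),
    (forall i, A (g i)) /\ forall x, A x -> exists c, x = \sum_i c i *: g i.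
  have [|T [g [gA gen]]] := H n (leqnn n) A sA.
    by move=> x _ j; rewrite leqNgt ltn_ord.
  exists #|T|, (g \o enum_val); split=> [i|x Ax]; first exact: gA.
  have [c ->] := gen x Ax; exists (c \o enum_val).
  rewrite (reindex (@enum_val T predT)) //=.
  by apply: onW_bij; apply: enum_val_bij.
move: A sA => _ _; elim: i => [_ A sA A0|i IH lt_in A sA A0].
  exists void, (fun x : void => match x with end); split=> [[]|x Ax].
  exists (fun=> 0); rewrite big1 => [|[]//].
  by apply/rowP => j; rewrite (A0 _ Ax) // mxE.
pose j0 := Ordinal lt_in.
pose J := [set x 0 j0 | x in A].
have iJ : ideal J.
  apply/idealP; split; first by exists 0; [exact: submod0|rewrite mxE].
  move=> a _ _ [x Ax <-] [y Ay <-]; exists (a *: x + y); last by rewrite !mxE.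
  by apply: submodD => //; apply: submodZ.
have [p [g]] := noeth J iJ; rewrite ideal_span_range => Jg.
have /choice[l lP] : forall t, exists x, A x /\ x 0 j0 = g t.
  move=> t; have : J (g t).
    rewrite Jg; exists (fun s => (s == t)%:R) => //.
    rewrite (bigD1 t) //= eqxx mul1r big1 ?addr0 // => s /negbTE->.
    by rewrite mul0r.
  by case=> x Ax xE; exists x.
have [||T [h [hA hgen]]] := IH (ltnW lt_in) (A `&` [set x | x 0 j0 = 0]).
- apply/submoduleP; split; first by split; [exact: submod0|rewrite /= mxE].
  move=> a u v [Au u0] [Av v0]; split.
    by apply: submodD => //; apply: submodZ.
  by rewrite /= !mxE u0 v0 mulr0 addr0.
- move=> x [Ax x0] j; rewrite leq_eqVlt => /orP[/eqP e|]; last exact: A0.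
  by rewrite -x0; congr (x 0 _); apply: val_inj.
exists ('I_p + T)%type, (fun s => match s with inl t => l t | inr t => h t end).
split=> [[t|t]|x Ax]; first by case: (lP t).
  by case: (hA t).
have : J (x 0 j0) by exists x.
rewrite Jg => -[c _ cE].
have [|d dE] := hgen (x - \sum_t c t *: l t).
  split; first by apply: submodB => //; apply: submod_comb => // t; case: (lP t).
  rewrite /= !mxE summxE -cE; apply/eqP; rewrite subr_eq0; apply/eqP.
  by apply: eq_bigr => t _; rewrite mxE; case: (lP t) => _ ->.
exists (fun s => match s with inl t => c t | inr t => d t end).
by rewrite big_sumType /= -dE addrC subrK.
Qed.

Section MinimalResolution.
Variables (R : comNzRingType) (k : fieldType) (pi : {rmorphism R -> k}).
Hypothesis noeth : noetherian R.
Hypothesis pi_surj : forall c, exists a, pi a = c.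
Hypothesis pi_unit : forall c, pi c != 0 -> exists c', c' * c = 1.

Lemma fbasis_rV n (A B : set 'rV[R]_n) : submodule A -> submodule B ->
  exists (p : nat) (v : 'I_p -> 'rV[R]_n), fbasis pi A B v.
Proof.
move=> sA sB; have [p [g [gA gen]]] := noetherian_rV noeth sA.
apply: (fbasis_exists pi_unit sB gA) => x Ax.
by have [c ->] := gen x Ax; exists c; rewrite subrr; apply: submod0.
Qed.

Lemma fbasis_R (A B : set R) : ideal A -> ideal B ->
  exists (p : nat) (v : 'I_p -> R), fbasis (V := R^o) pi A B v.
Proof.
move=> iA iB; have [p [g]] := noeth iA; rewrite ideal_span_range => Ag.
apply: (@fbasis_exists _ _ _ pi_unit R^o A B p g iB) => [i|x].
  rewrite Ag; exists (fun s => (s == i)%:R) => //.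
  rewrite (bigD1 i) //= eqxx mul1r big1 ?addr0 // => s /negbTE->.
  by rewrite mul0r.
by rewrite Ag => -[c _ <-]; exists c; rewrite subrr; apply: ideal0.
Qed.

(** Independence modulo [[set 0]] says that every relation has coefficients in the kernel of [pi],
    so an [fbasis] of [A] over zero is a minimal generating family. *)
Lemma minimal_cover n (A : set 'rV[R]_n) : submodule A ->
  exists p (f : {linear 'rV[R]_p -> 'rV[R]_n}),
    range f = A /\ forall x, f x = 0 -> forall j, pi (x 0 j) = 0.
Proof.
move=> sA; have [p [v [vA vB vC]]] := fbasis_rV sA (@submodule_set0 R 'rV_n).
exists p, (comb v); split; last by move=> x fx; apply: vC.
apply/seteqP; split=> [_ [x _ <-]|x Ax]; first exact: submod_comb.
have [c /subr0_eq ->] := vB _ Ax; exists (\row_i c i) => //.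
exact: comb_row.
Qed.

(** A syzygy bundled with the rank of its ambient free module, so that passing to the next syzygy
    can be iterated although the types change. *)
Record submod_state := SubmodState {
  st_n : nat; st_set : set 'rV[R]_st_n; st_sub : submodule st_set }.

Lemma next_state_exists (s : submod_state) :
  exists (t : submod_state) (f : {linear 'rV[R]_(st_n t) -> 'rV[R]_(st_n s)}),
    [/\ range f = @st_set s, @st_set t = [set x | f x = 0] &
    forall x, f x = 0 -> forall j, pi (x 0 j) = 0].
Proof.
have [p [f [fr fm]]] := minimal_cover (st_sub s).
by exists (SubmodState (submodule_ker f)), f.
Qed.

Definition next_state s := projT1 (cid (next_state_exists s)).
Definition next_diff s : {linear 'rV[R]_(st_n (next_state s)) -> 'rV[R]_(st_n s)} :=
  projT1 (cid (projT2 (cid (next_state_exists s)))).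

Lemma next_diffP s : [/\ range (next_diff s) = @st_set s,
    @st_set (next_state s) = [set x | next_diff s x = 0] &
    forall x, next_diff s x = 0 -> forall j, pi (x 0 j) = 0].
Proof. exact: (projT2 (cid (projT2 (cid (next_state_exists s))))). Qed.

Definition residue_aug : {linear 'rV[R]_1 -> restr pi} :=
  comb (fun=> (1 : k) : restr pi).

Lemma residue_augE x : residue_aug x = pi (x 0 0).
Proof. by rewrite /= /comb big_ord1; apply: mulr1. Qed.

Definition residue_state := SubmodState (submodule_ker residue_aug).

Lemma minimal_resolution_exists :
  exists F : free_resolution (restr pi),
  forall n x, range (fr_diff F n) x -> forall j, pi (x 0 j) = 0.
Proof.
pose st n := iter n next_state residue_state.
pose d n := next_diff (st n).
have e0 : [set x | residue_aug x = 0] = range (d 0%N).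
  by have [-> _ _] := next_diffP (st 0%N).
have eS n : [set x | d n x = 0] = range (d n.+1).
  have [-> _ _] := next_diffP (st n.+1).
  by have [_ -> _] := next_diffP (st n).
have eA : range residue_aug = setT.
  apply/seteqP; split=> // y _; have [a ay] := pi_surj y.
  by exists (\row__ a) => //; rewrite residue_augE mxE.
exists (@FreeResolution R (restr pi) (fun n => st_n (st n)) d _ eA e0 eS).
case=> [|n] x /= xr j.
  have := e0; rewrite predeqE => /(_ x)[_ /(_ xr)] /=.
  by rewrite [j]ord1 => <-; rewrite -residue_augE.
have := eS n; rewrite predeqE => /(_ x)[_ /(_ xr)] /=.
by have [_ _ h] := next_diffP (st n) => dx; exact: (h x dx j).
Qed.

End MinimalResolution.

(** * Comparison of resolutions *)

(** Chain maps and homotopies have components whose type depends on the degree; [P] is the invariant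
    that keeps the next choice possible. *)
Lemma dependent_choice_nat (T : nat -> Type) (P : forall n, T n -> Prop)
    (Q : forall n, T n -> T n.+1 -> Prop) (t0 : T 0%N) : P 0%N t0 ->
  (forall n t, P n t -> exists t', P n.+1 t' /\ Q n t t') ->
  exists f : forall n, T n, f 0%N = t0 /\ forall n, Q n (f n) (f n.+1).
Proof.
move=> P0 step.
pose next n (t : {t : T n | P n t}) : {t : T n.+1 | P n.+1 t} :=
  let w := cid (step n (sval t) (svalP t)) in exist _ (sval w) (svalP w).1.
pose f := fix f n := match n return {t : T n | P n t} with
  | 0 => exist _ t0 P0 | n'.+1 => next n' (f n') end.
exists (fun n => sval (f n)); split=> // n /=.
by case: cid => t' [].
Qed.

Section Comparison.
Variables (R : comNzRingType) (M : lmodType R).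
Implicit Types F G : free_resolution M.

Lemma fr_aug_diff F x : fr_aug F (fr_diff F 0 x) = 0.
Proof.
by have := fr_exact0 F; rewrite predeqE => /(_ (fr_diff F 0 x))[_]; apply; exists x.
Qed.

Lemma fr_diff_diff F n x : fr_diff F n (fr_diff F n.+1 x) = 0.
Proof.
have := fr_exactS F n; rewrite predeqE => /(_ (fr_diff F n.+1 x))[_]; apply.
by exists x.
Qed.

Lemma fr_aug_ker F x : fr_aug F x = 0 -> range (fr_diff F 0) x.
Proof. by have := fr_exact0 F; rewrite predeqE => /(_ x)[]. Qed.

Lemma fr_diff_ker F n x : fr_diff F n x = 0 -> range (fr_diff F n.+1) x.
Proof. by have := fr_exactS F n; rewrite predeqE => /(_ x)[]. Qed.

Lemma chain_map_exists F G :
  exists f : forall n, {linear 'rV[R]_(fr_rank F n) -> 'rV[R]_(fr_rank G n)},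
    (forall x, fr_aug G (f 0%N x) = fr_aug F x) /\
    forall n x, fr_diff G n (f n.+1 x) = f n (fr_diff F n x).
Proof.
have [f0 f0P] : exists f0 : {linear 'rV[R]_(fr_rank F 0) -> 'rV[R]_(fr_rank G 0)},
    forall x, fr_aug G (f0 x) = fr_aug F x.
  by apply: linear_lift => x; rewrite fr_aug_surj.
have [|n t h|f [f0E fS]] := @dependent_choice_nat
  (fun n => {linear 'rV[R]_(fr_rank F n) -> 'rV[R]_(fr_rank G n)})
  (* The invariant is the hypothesis of [linear_lift] for the next component. *)
  (fun n f => forall x, range (fr_diff G n) (f (fr_diff F n x)))
  (fun n f f' => forall x, fr_diff G n (f' x) = f (fr_diff F n x)) f0.
- by move=> x; apply: fr_aug_ker; rewrite f0P fr_aug_diff.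
- have [t' t'P] := linear_lift (f := t \o fr_diff F n) (p := fr_diff G n) h.
  exists t'; split=> // x; apply: fr_diff_ker.
  by rewrite t'P /= fr_diff_diff linear0.
by exists f; rewrite f0E.
Qed.

(** At each stage the defect [f n.+1 x - h (fr_diff F n x)] is a cycle, hence a boundary by
    exactness of [G], and the homotopy extends. It serves for differences between a round trip and
    the identity. *)
Lemma null_homotopy F G
    (f : forall n, {linear 'rV[R]_(fr_rank F n) -> 'rV[R]_(fr_rank G n)}) :
  (forall x, fr_aug G (f 0%N x) = 0) ->
  (forall n x, fr_diff G n (f n.+1 x) = f n (fr_diff F n x)) ->
  exists h : forall n, {linear 'rV[R]_(fr_rank F n) -> 'rV[R]_(fr_rank G n.+1)},
    (forall x, f 0%N x = fr_diff G 0 (h 0%N x)) /\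
    forall n x, f n.+1 x = fr_diff G n.+1 (h n.+1 x) + h n (fr_diff F n x).
Proof.
move=> f0 fS.
have [h0 h0P] : exists h : {linear 'rV[R]_(fr_rank F 0) -> 'rV[R]_(fr_rank G 1)},
    forall x, fr_diff G 0 (h x) = f 0%N x.
  by apply: linear_lift => x; apply: fr_aug_ker.
have [|n t th|h [h0E hS]] := @dependent_choice_nat
  (fun n => {linear 'rV[R]_(fr_rank F n) -> 'rV[R]_(fr_rank G n.+1)})
  (fun n h => forall x, range (fr_diff G n.+1) (f n.+1 x - h (fr_diff F n x)))
  (fun n h h' => forall x,
     fr_diff G n.+1 (h' x) = f n.+1 x - h (fr_diff F n x)) h0.
- move=> x; apply: fr_diff_ker; rewrite linearB fS /=.
  by rewrite h0P subrr.
- have [t' t'P] := linear_lift (f := f n.+1 \- (t \o fr_diff F n))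
    (p := fr_diff G n.+1) th.
  exists t'; split=> // x; apply: fr_diff_ker; rewrite linearB fS t'P /=.
  by rewrite fr_diff_diff linear0 subr0 subrr.
by exists h; split=> [x|n x]; [rewrite h0E h0P|rewrite hS subrK].
Qed.

End Comparison.

Section Betti.
Variables (R : comNzRingType) (k : fieldType) (pi : {rmorphism R -> k}).
Hypothesis pi_surj : forall c, exists a, pi a = c.

Lemma scale_restr a (x : restr pi) : a *: x = pi a * (x : k) :> k.
Proof. by []. Qed.

Variable M : lmodType R.
Implicit Types F G : free_resolution M.

Definition minimal F := forall n x, range (fr_diff F n) x ->
  forall j, pi (x 0 j) = 0.

Lemma coboundaries_submodule G n : submodule (ext_coboundaries G (restr pi) n).
Proof.
case: n => [|n]; first exact: submodule_set0.
apply/submoduleP; split.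
  by exists (fun=> 0) => // a x y; rewrite scaler0 addr0.
move=> a u v [g gL uE] [h hL vE]; exists (fun x => a *: g x + h x).
  move=> b x y; rewrite gL hL !scalerDr addrACA scalerA mulrC -scalerA.
  by [].
by move=> x; rewrite -uE -vE.
Qed.

Lemma linear_restr0 n (f : 'rV[R]_n -> restr pi) (x : 'rV[R]_n) :
  linear f -> (forall j, pi (x 0 j) = 0) -> f x = 0.
Proof.
move=> fL x0; have f0 : f 0 = 0.
  by have := fL (-1) 0 0; rewrite scaler0 addr0 scaleN1r addNr.
pose L := HB.pack_for {linear 'rV[R]_n -> restr pi} f
  (GRing.isLinear.Build R _ _ _ f fL).
rewrite -[f x]/(L x) (rV_basisE x) linear_sum big1 // => j _.
by rewrite linearZ /= scale_restr x0 mul0r.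
Qed.

(** [betti] admits any free resolution [G], which is compared here with a minimal one by
    [f : G -> F] and [g : F -> G]. The basis consists of the coordinates of [F_n] reduced by [pi]
    and pulled back along [f]: they generate because [g f] is homotopic to the identity, and are
    independent because [f g] is the identity modulo the kernel of [pi]. *)
Lemma fbasis_ext F G n : minimal F ->
  exists v, fbasis pi (ext_cocycles G (restr pi) n)
    (ext_coboundaries G (restr pi) n) (v : 'I_(fr_rank F n) -> _).
Proof.
move=> minF.
have [f [f0 fS]] := chain_map_exists G F.
have [g [g0 gS]] := chain_map_exists F G.
have [h [h0 hS]] : exists h : forall n,
    {linear 'rV[R]_(fr_rank G n) -> 'rV[R]_(fr_rank G n.+1)},
    (forall x, g 0%N (f 0%N x) - x = fr_diff G 0 (h 0%N x)) /\
    forall n x, g n.+1 (f n.+1 x) - x = fr_diff G n.+1 (h n.+1 x) + h n (fr_diff G n x).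
  apply: (null_homotopy (f := fun n => (g n \o f n) \- idfun)) => [x|i x] /=.
    by rewrite linearB g0 f0 subrr.
  by rewrite linearB gS fS.
have [h' [h'0 h'S]] : exists h : forall n,
    {linear 'rV[R]_(fr_rank F n) -> 'rV[R]_(fr_rank F n.+1)},
    (forall x, f 0%N (g 0%N x) - x = fr_diff F 0 (h 0%N x)) /\
    forall n x, f n.+1 (g n.+1 x) - x = fr_diff F n.+1 (h n.+1 x) + h n (fr_diff F n x).
  apply: (null_homotopy (f := fun n => (f n \o g n) \- idfun)) => [x|i x] /=.
    by rewrite linearB f0 g0 subrr.
  by rewrite linearB fS gS.
(* Both homotopy terms have entries in the kernel of [pi], by minimality of [F]. *)
have fgE i x j : pi (f i (g i x) 0 j) = pi (x 0 j).
  apply/eqP; rewrite -subr_eq0 -rmorphB; apply/eqP.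
  have -> : f i (g i x) 0 j - x 0 j = (f i (g i x) - x) 0 j by rewrite !mxE.
  case: i x j => [|i] x j; first by rewrite h'0; apply: minF; exists (h' 0%N x).
  rewrite h'S mxE rmorphD minF ?add0r; last by exists (h' i.+1 x).
  have /cwise_linear/(_ _) : cwise [set a | pi a = 0] (fr_diff F i x).
    by move=> l; apply: minF; exists x.
  apply; apply/idealP; split; first by rewrite /= rmorph0.
  by move=> a u v /= u0 v0; rewrite rmorphD rmorphM u0 v0 mulr0 addr0.
(* On a cocycle only the term [u h d] of the homotopy survives, and it is a coboundary; in degree 0
   nothing survives. *)
have cobP i (u : fr_maps G (restr pi) i) :
    linear u -> (forall x, u (fr_diff G i x) = 0) ->
    ext_coboundaries G (restr pi) i (fun y => u (g i (f i y) - y)).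
  case: i u => [|i] u uL u0 /=.
    by apply/funext => y; rewrite h0 u0.
  exists (fun z => u (h i z)) => [a x y|x]; first by rewrite linearP uL.
  by rewrite hS -[fr_diff G _ _]scale1r uL u0 scaler0 add0r.
(* Composed with [g], a coboundary is a linear map evaluated at [fr_diff F i x], whose entries have
   residue zero; independence can then be tested on unit vectors. *)
have cob0 i (u : fr_maps G (restr pi) i) :
    ext_coboundaries G (restr pi) i u -> forall x, u (g i x) = 0.
  case: i u => [|i] u /=; first by move=> ->.
  move=> [w wL uE] x; rewrite uE gS.
  apply: (linear_restr0 (f := w \o g i)) => [a y z|]; first by rewrite /= linearP wL.
  by apply: minF; exists x.
pose v (i : 'I_(fr_rank F n)) : fr_maps G (restr pi) n :=
  fun y => (pi (f n y 0 i) : restr pi).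
have sumE c y : (\sum_i c i *: v i : fr_maps G (restr pi) n) y =
    \sum_i pi (c i) * pi (f n y 0 i).
  by rewrite fct_sumE; apply: eq_bigr.
exists v; split=> [i|u [uL u0]|c Bc i].
- split=> [a x y|x].
    by rewrite /v linearP !mxE rmorphD rmorphM.
  by rewrite /v -fS; apply: minF; exists (f n.+1 x).
- have /choice[c cP] : forall i, exists a, pi a = u (g n (delta_mx 0 i)).
    by move=> i; apply: pi_surj.
  pose L := HB.pack_for {linear 'rV[R]_(fr_rank G n) -> restr pi} u
    (GRing.isLinear.Build R _ _ _ u uL).
  have ugf y : u (g n (f n y)) = (\sum_i c i *: v i : fr_maps G (restr pi) n) y.
    rewrite sumE {1}(rV_basisE (f n y)) linear_sum -[LHS]/(L _) linear_sum.
    by apply: eq_bigr => i _; rewrite !linearZ /= scale_restr -cP mulrC.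
  exists c.
  have -> : u - \sum_i c i *: v i = - (fun y => u (g n (f n y) - y)).
    apply/funext => y; rewrite !fctE /= -ugf -[u]/(L : _ -> _) linearB /=.
    by rewrite opprB.
  by apply: submodN; [apply: coboundaries_submodule | apply: cobP].
- have := cob0 _ _ Bc (delta_mx 0 i); rewrite sumE (bigD1 i) //= big1.
    by rewrite addr0 fgE mxE !eqxx rmorph1 mulr1.
  by move=> j ne; rewrite fgE mxE eqxx (negbTE ne) rmorph0 mulr0.
Qed.

(** Every resolution [G] gives the same rank, so the choice made in the definition of [betti] is
    harmless. *)
Lemma betti_minimal F n : minimal F -> betti pi M n = fr_rank F n.
Proof.
move=> minF.
suff rk G : rank pi (ext_cocycles G (restr pi) n)
    (ext_coboundaries G (restr pi) n) = fr_rank F n.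
  by apply: xget_unique => [|b [G ->]]; [exists F; rewrite rk | apply: rk].
have [v vb] := fbasis_ext G n minF.
rewrite (rank_fbasis pi_surj _ _ vb) ?card_ord //.
  exact: coboundaries_submodule.
move=> a x a0 _; rewrite (_ : a *: x = 0).
  by apply: submod0; apply: coboundaries_submodule.
by apply/funext => y; apply: etrans (scale_restr _ _) _; rewrite a0 mul0r.
Qed.

End Betti.

(** * Local rings with m^3 = 0 and m^2 of rank one *)

Section LocalRing.
Variables (R : comNzRingType) (m : set R) (k : fieldType).
Variable pi : {rmorphism R -> k}.
Hypothesis hR : local_ring m pi.
Hypothesis hm3 : ideal_pow m 3 = [set 0].

Lemma local_noetherian : noetherian R. Proof. by case: hR. Qed.

Lemma local_surj c : exists a, pi a = c.
Proof.
case: hR => _ _ _ + _; rewrite predeqE => /(_ c)[_ /(_ I)[a _ <-]].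
by exists a.
Qed.

Lemma local_ker x : m x <-> pi x = 0.
Proof. by case: hR => _ _ _ _; rewrite predeqE => /(_ x)[h h']; split. Qed.

Lemma local_ideal : ideal m. Proof. by case: hR => _ []. Qed.

Lemma mul3_eq0 a b c : m a -> m b -> m c -> a * (b * c) = 0.
Proof.
move=> ma mb mc; have : ideal_pow m 3 (a * (b * c)).
  by apply: mem_ideal_powS => //; apply: mem_ideal_pow2 => //; apply: local_ideal.
by rewrite hm3.
Qed.

Lemma local_unit c : pi c != 0 -> exists c', c' * c = 1.
Proof.
move=> c0; have [d dc] := local_surj (pi c)^-1.
pose t := 1 - d * c; have mt : m t.
  by apply/local_ker; rewrite rmorphB rmorphM rmorph1 dc mulVf // subrr.
(* Geometric series: [d * c = 1 - t] and [t] has cube zero. *)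
exists ((1 + t + t * t) * d).
transitivity (1 - t * (t * t)); last by rewrite mul3_eq0 ?subr0.
by rewrite /t; ring.
Qed.

Lemma mul_pow2_eq0 a x : m a -> ideal_pow m 2 x -> a * x = 0.
Proof.
by move=> ma px; have := mem_ideal_powS ma px; rewrite hm3.
Qed.

Lemma pow2_sub : ideal_pow m 2 `<=` m.
Proof.
have im := local_ideal.
by apply: ideal_pow2_sub => // a b _ mb; apply: ideal_mull.
Qed.

Lemma ideal_pow_ge3 n : (3 <= n)%N -> ideal_pow m n = [set 0].
Proof.
elim: n => // n IH; rewrite leq_eqVlt => /orP[/eqP<-//|le3n].
apply/seteqP; split=> [x /ideal_pow_decr|_ ->]; first by rewrite IH.
exact: ideal0 (ideal_powP _ _).
Qed.

Variable w : R.
Hypothesis pow2E : ideal_pow m 2 = range (fun a => a * w).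
Hypothesis w_ann : forall a, a * w = 0 -> m a.

Lemma pow2_w : ideal_pow m 2 w.
Proof. by rewrite pow2E; exists 1; rewrite ?mul1r. Qed.

Lemma w_neq0 : w <> 0.
Proof.
move=> w0; have /w_ann/local_ker : 1 * w = 0 by rewrite w0 mulr0.
by rewrite rmorph1 => /eqP; rewrite oner_eq0.
Qed.

Lemma mulw_eq0 a : m a -> a * w = 0.
Proof. by move=> ma; apply: mul_pow2_eq0 => //; exact: pow2_w. Qed.

Lemma mul_w a b : m a -> m b -> exists c, a * b = c * w.
Proof.
move=> ma mb; have := mem_ideal_pow2 local_ideal ma mb.
by rewrite pow2E => -[c _ <-]; exists c.
Qed.

Lemma w_multiple x : ideal_pow m 2 x -> x <> 0 -> exists a, a * x = w.
Proof.
rewrite pow2E => -[b _ <-] bw; have [|a ab] := @local_unit b.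
  by apply/eqP => /local_ker mb; apply: bw; apply: mulw_eq0.
by exists a; rewrite mulrA ab mul1r.
Qed.

Lemma sqr_multiple x y z : m x -> x * x <> 0 -> m y -> m z ->
  exists c, y * z = c * (x * x).
Proof.
move=> mx x0 my mz; have [c ->] := mul_w my mz.
have [a <-] := w_multiple (mem_ideal_pow2 local_ideal mx mx) x0.
by exists (c * a); rewrite mulrA.
Qed.

(** For the form with values in [m^2]: an isotropic [y] outside the radical, and a partner [u]
    scaled so that the value is [w]. *)
Definition isotropic_pair y u := [/\ m y, m u, y * y = 0 & y * u = w].

(** Two orthogonal anisotropic vectors; [c] is the ratio of their squares. *)
Definition orthogonal_pair x y c := [/\ m x, m y, x * x <> 0, x * y = 0 &
  y * y = c * (x * x) /\ pi c != 0].

Definition rank_one x := [/\ m x, x * x <> 0 &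
  forall t, m t -> exists c, annihilator m (t - c * x)].

(** If all squares vanish, any [y] outside the radical is isotropic. Otherwise take [x] anisotropic:
    an element orthogonal to [x] and outside the radical is isotropic or completes an orthogonal
    pair, and if there is none, projecting along [x] shows that [x] spans [m] modulo the radical. *)
Lemma trichotomy : (exists y u, isotropic_pair y u) \/
  (exists x y c, orthogonal_pair x y c) \/ exists x, rank_one x.
Proof.
have nonrad y : m y -> ~ annihilator m y -> y * y = 0 ->
    exists y u, isotropic_pair y u.
  move=> my + yy; move=> /existsNP[t /not_implyP[mt ty]].
  have [a aw] := w_multiple (mem_ideal_pow2 local_ideal mt my) ty.
  exists y, (a * t); split=> //; first by apply: (ideal_mull _ local_ideal).
  by rewrite -aw; ring.
have [[x [mx xx]]|sq0] := pselect (exists x, m x /\ x * x <> 0); last first.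
  left; have sq x : m x -> x * x = 0.
    by move=> mx; apply: contrapT => xx; apply: sq0; exists x.
  have [[y [my ny]]|rad] := pselect (exists y, m y /\ ~ annihilator m y).
    by apply: (nonrad y) => //; apply: sq.
  case: w_neq0; have : ideal_pow m 2 `<=` [set 0].
    apply: (ideal_pow2_sub local_ideal (@submodule_set0 R R^o)) => a b ma mb.
    apply: contrapT => ab; apply: rad; exists b; split=> //.
    by move=> /(_ a ma).
  by apply; apply: pow2_w.
have [[y [my xy ny]]|rad] := pselect (exists y, [/\ m y, x * y = 0 & ~ annihilator m y]).
  have [yy|yy] := pselect (y * y = 0); first by left; apply: (nonrad y).
  right; left; have [c cE] := sqr_multiple mx xx my my.
  exists x, y, c; split=> //; split=> //; apply/eqP => /local_ker mc.
  apply: yy; rewrite cE; apply: mul_pow2_eq0 => //.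
  by apply: mem_ideal_pow2 => //; apply: local_ideal.
right; right; exists x; split=> // t mt.
have [c cE] := sqr_multiple mx xx mx mt; exists c.
apply: contrapT => nt; apply: rad; exists (t - c * x); split=> //.
  by apply: (idealB local_ideal) => //; apply: (ideal_mull _ local_ideal).
by rewrite mulrBr cE; ring.
Qed.

Lemma ann_sub : annihilator m `<=` m.
Proof.
move=> x xm; apply: w_ann; rewrite mulrC; apply: xm.
by apply: pow2_sub; apply: pow2_w.
Qed.

Lemma pow2_sub_ann : ideal_pow m 2 `<=` annihilator m.
Proof. by move=> x px a ma; apply: mul_pow2_eq0. Qed.

(* d is the rank of the bilinear form m / m^2 x m / m^2 -> m^2 induced by the product. *)
Lemma socle_rank :
  exists (d : nat) (v : 'I_d -> R), fbasis (V := R^o) pi m (annihilator m) v /\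
  (rank (V := R^o) pi m (ideal_pow m 2) =
     d + (rank (V := R^o) pi (annihilator m) [set 0%R]).-1)%N /\
  (0 < rank (V := R^o) pi (annihilator m) [set 0%R])%N.
Proof.
have i2 : ideal (ideal_pow m 2) by apply: ideal_powP.
have i0 : ideal [set 0 : R] by exact: (@submodule_set0 R R^o).
have ia : ideal (annihilator m) by apply: annihilatorP.
have im := local_ideal.
have [d [v vb]] := fbasis_R local_noetherian local_unit im ia.
have [q [u ub]] := fbasis_R local_noetherian local_unit ia i2.
have wb : fbasis (V := R^o) pi (ideal_pow m 2) [set 0] (fun _ : 'I_1 => w).
  split=> [_|x|c /=]; first exact: pow2_w.
    by rewrite pow2E => -[a _ <-]; exists (fun=> a); rewrite big_ord1 /= subrr.
  by rewrite big_ord1 => /w_ann/local_ker c0 i; rewrite [i]ord1.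
(* With [q] the rank of [annihilator m] over [m^2], the first filtration gives [e = d + q] and the
   second [s = q + 1]. *)
have eb := fbasis_cat ia i2 ann_sub pow2_sub_ann _ vb ub.
have sb := fbasis_cat i2 i0 pow2_sub_ann _ _ ub wb.
have -> := rank_fbasis local_surj i2 _ (eb _); first last.
- by move=> a x /local_ker ma mx; apply: mem_ideal_pow2.
- by move=> a x /local_ker ma mx; apply: mem_ideal_pow2.
have -> := rank_fbasis local_surj i0 _ (sb _ _); first last.
- by move=> a x /local_ker ma ax; apply: ax.
- by move=> _ /= ->; apply: ideal0.
- by move=> a x /local_ker ma ax; apply: ax.
by exists d, v; rewrite !card_sum !card_ord addn1.
Qed.

(** Since [e = d + s - 1] with [s] positive, [s < e] means that [d] is at least 2, which excludes
    [rank_one], and [e <= s] means that [d] is at most 1. *)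
Lemma rank_one_or (e s : nat) :
  e = rank (V := R^o) pi m (ideal_pow m 2) ->
  s = rank (V := R^o) pi (annihilator m) [set 0] ->
  ((s < e)%N -> (exists y u, isotropic_pair y u) \/
    exists x y c, orthogonal_pair x y c) /\
  ((e <= s)%N -> exists x, rank_one x).
Proof.
move=> -> ->; have [d [v [vb [-> s0]]]] := socle_rank.
set r := rank _ _ _ in s0 *.
have ia : ideal (annihilator m) by apply: annihilatorP.
split=> [lt_se|le_es].
  case: trichotomy => [|[]]; [by left|by right|move=> [x [mx xx xgen]]].
  have xb : fbasis (V := R^o) pi m (annihilator m) (fun _ : 'I_1 => x).
    split=> [//|t mt|c].
      by have [c cE] := xgen t mt; exists (fun=> c); rewrite big_ord1.
    rewrite big_ord1 => /(_ x mx) xc0 i; rewrite [i]ord1.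
    apply/eqP/negP => /negP/local_unit[a ac]; apply: xx.
    have <- : a * (x * (c 0 * x)) = x * x.
      by rewrite -[RHS]mul1r -ac; ring.
    by rewrite [x * _]xc0 mulr0.
  have d1 : 1%N = d.
    have := fbasis_card local_surj ia _ vb xb; rewrite !card_ord; apply.
    by move=> a x' /local_ker ma mx' b mb; apply: mul3_eq0.
  by move: lt_se; rewrite -d1 add1n prednK // ltnn.
have d1 : (d <= 1)%N.
  by move: le_es; rewrite -[X in (_ <= X)%N](prednK s0) -add1n leq_add2r.
have [x [mx xgen]] :
    exists x, m x /\ forall t, m t -> exists c, annihilator m (t - c * x).
  case: vb => vm vgen _; clear le_es; case: d d1 v vm vgen => [|[|//]] _ v vm vgen.
    exists 0; split=> [|t mt]; first exact: ideal0 local_ideal.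
    by exists 0; have [c] := vgen t mt; rewrite big_ord0 mul0r.
  exists (v 0); split=> // t mt.
  by have [c] := vgen t mt; rewrite big_ord1; exists (c 0).
(* Every element of [m] is a multiple of [x] up to the annihilator, so [x * x = 0] would kill [m^2].
   This also disposes of [d = 0], where [x] was taken to be 0. *)
exists x; split=> // xx; apply: w_neq0.
have : ideal_pow m 2 `<=` [set 0]; last by apply; apply: pow2_w.
apply: (ideal_pow2_sub local_ideal (@submodule_set0 R R^o)) => a b ma mb /=.
 have [c ca] := xgen a ma; have [c' cb] := xgen b mb.
have -> : a * b = a * (b - c' * x) + c' * (x * (a - c * x)) + c' * c * (x * x).
  by ring.
by rewrite cb // ca // xx !mulr0 !addr0.
Qed.

End LocalRing.

(** The value 1 differs from the default 0 of [rank], so it comes from an actual basis. *)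
Lemma socle_generator (R : comNzRingType) (m : set R) (k : fieldType)
    (pi : {rmorphism R -> k}) : local_ring m pi ->
  rank (V := R^o) pi (ideal_pow m 2) [set 0] = 1%N ->
  exists w, ideal_pow m 2 = range (fun a => a * w) /\
    forall a, a * w = 0 -> m a.
Proof.
move=> hR; rewrite /rank; case: xgetP => // _ -> [v] + r1.
rewrite r1 in v * => -[vA vB vC]; exists (v 0); split.
  apply/seteqP; split=> [x /vB[c]|_ [a _ <-]]; last first.
    by apply: (ideal_mull a (ideal_powP m 2)); apply: vA.
  by rewrite big_ord1 => /subr0_eq ->; exists (c 0).
move=> a aw; apply/(local_ker hR); apply: (vC (fun=> a) _ 0).
by rewrite big_ord1.
Qed.

(** * Linearity of the minimal resolution of k *)

Section Resolution.
Variables (R : comNzRingType) (m : set R) (k : fieldType).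
Variable pi : {rmorphism R -> k}.
Hypothesis hR : local_ring m pi.
Hypothesis hm3 : ideal_pow m 3 = [set 0].
Variable w : R.
Hypothesis pow2E : ideal_pow m 2 = range (fun a => a * w).
Hypothesis w_ann : forall a, a * w = 0 -> m a.
Variable F : free_resolution (restr pi).
Hypothesis minF : minimal pi F.

Local Notation im := (local_ideal hR).
Local Notation d n := (fr_diff F n).
Local Notation FF n := 'rV[R]_(fr_rank F n).

Lemma cwise_m n (x : 'rV[R]_n) : cwise m x <-> forall j, pi (x 0 j) = 0.
Proof. by split=> h j; apply/(local_ker hR); apply: h. Qed.

Lemma range_diff_m n : range (d n) `<=` cwise m (n:=_).
Proof. by move=> x xr; apply/cwise_m => j; apply: minF. Qed.

Lemma submodule_range n : submodule (range (d n)).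
Proof. by apply: submodule_image; apply: submoduleT. Qed.

Lemma range_diff0 : range (d 0%N) = cwise m (n:=_).
Proof.
apply/seteqP; split; first exact: range_diff_m.
by move=> x /cwise_m x0; apply: fr_aug_ker; apply: linear_restr0 => //; apply: linearP.
Qed.

Lemma cwise_smul a n (I J : set R) (x : 'rV[R]_n) :
  (forall b, I b -> J (a * b)) -> cwise I x -> cwise J (a *: x).
Proof. by move=> h Ix j; rewrite mxE; apply: h. Qed.

Lemma smul_m_cwise n (x : 'rV[R]_n) a :
  m a -> cwise m x -> cwise (ideal_pow m 2) (a *: x).
Proof. by move=> ma; apply: cwise_smul => b; apply: mem_ideal_pow2 => //; exact: im. Qed.

Lemma smul_m_pow2 n (x : 'rV[R]_n) a :
  m a -> cwise (ideal_pow m 2) x -> a *: x = 0.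
Proof.
by move=> ma x2; apply/rowP => j; rewrite !mxE (mul_pow2_eq0 hm3).
Qed.

Lemma cwise_pow2 n (z : 'rV[R]_n) :
  cwise (ideal_pow m 2) z -> exists y, z = w *: y.
Proof.
move=> z2; have /choice[c cP] : forall j, exists a, z 0 j = a * w.
  by move=> j; have := z2 j; rewrite pow2E => -[a _ <-]; exists a.
by exists (\row_j c j); apply/rowP => j; rewrite !mxE cP mulrC.
Qed.

Lemma smul_range n :
  ideal_smul m (range (d n)) = d n @` cwise m (n:=_).
Proof.
apply/seteqP; split.
  apply: smul_sub => [|a _ ma [x _ <-]].
    by apply: submodule_image; apply: cwise_submodule; exact: im.
  exists (a *: x); last by rewrite linearZ.
  by move=> j; rewrite mxE; apply: (ideal_mulr _ im).
move=> _ [x mx <-]; rewrite (rV_basisE x) linear_sum.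
apply: submod_sum => [|j]; first exact: submodule_smul.
by rewrite linearZ; apply: mem_smul => //; exists (delta_mx 0 j).
Qed.

Lemma smul_range_sub n :
  ideal_smul m (range (d n)) `<=` cwise (ideal_pow m 2) (n:=_).
Proof.
apply: smul_sub => [|a x ma /range_diff_m mx].
  by apply: cwise_submodule; apply: ideal_powP.
exact: smul_m_cwise.
Qed.

Lemma diff_cwise_pow n i (x : FF n.+1) :
  cwise (ideal_pow m i) x -> cwise (ideal_pow m i.+1) (d n x).
Proof.
move=> xi; rewrite (rV_basisE x) linear_sum; apply: submod_sum => [|j].
  by apply: cwise_submodule; apply: ideal_powP.
rewrite linearZ => l /=; rewrite mxE mulrC; apply: (mem_ideal_powS _ (xi j)).
by apply: (@range_diff_m n (d n (delta_mx 0 j))); exists (delta_mx 0 j).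
Qed.

Lemma diff_pow2_eq0 n (x : FF n.+1) : cwise (ideal_pow m 2) x -> d n x = 0.
Proof.
by move/diff_cwise_pow; rewrite hm3 => x0; apply/rowP => j; rewrite mxE; apply: x0.
Qed.

(** The inclusion opposite to [smul_range_sub]: together they say that [m Om = m^2 F_n] for the
    syzygy [Om = range (d n)]. *)
Definition linear_at n :=
  cwise (ideal_pow m 2) (n:=_) `<=` ideal_smul m (range (d n)).

Lemma linear_at0 : linear_at 0.
Proof.
move=> z z2; rewrite range_diff0 (rV_basisE z).
apply: submod_sum => [|j]; first exact: submodule_smul.
have sS := @submodule_smul R (FF 0) m (cwise m (n:=_)).
pose J := [set a | ideal_smul m (cwise m (n:=_)) (a *: (delta_mx 0 j : FF 0))].
have iJ : ideal J.
  apply/idealP; split=> [|a u v Ju Jv]; first by rewrite /J /= scale0r; apply: submod0.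
  by rewrite /J /= scalerDl -scalerA; apply: (submodD sS _ Jv); apply: (submodZ _ sS Ju).
apply: (ideal_pow2_sub im iJ _ (z2 j)) => a b ma mb.
rewrite /J /= -scalerA; apply: mem_smul => // i.
by rewrite mxE; apply: (ideal_mulr _ im).
Qed.

(** * Linearity from an element of square zero *)

Section Pair.
Variables (x y c u0 v0 : R).
Hypotheses (mx : m x) (my : m y) (xy0 : x * y = 0) (yyE : y * y = c * (x * x)).
Hypotheses (mu0 : m u0) (mv0 : m v0).
(** Read with [T^2 = - c], these say that [(u0 + T v0) (T x + y) = w]. *)
Hypotheses (uv1 : y * u0 - c * x * v0 = w) (uv0 : x * u0 + y * v0 = 0).

(* Read over R[T] / (T^2 + c): with z = T x + y, which squares to 0, the condition
   says that (u + T v) z = a + T b. *)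
Let solvable n (a b : FF n) := exists u v : FF n,
  [/\ range (d n) u, range (d n) v, y *: u - (c * x) *: v = a &
      x *: u + y *: v = b].

(** Multiplication by [T] sends [u + T v] to [- c v + T u], and [a] to [T a]. *)
Lemma solvable_swap n (a : FF n) : solvable a 0 -> solvable 0 a.
Proof.
move=> [u [v [ru rv ea e0]]]; exists (- c *: v), u; split=> //.
- exact: submodZ (@submodule_range n) rv.
- transitivity (- c *: (x *: u + y *: v)); last by rewrite e0 scaler0.
  by apply/rowP => j; rewrite !mxE; ring.
- by rewrite -ea; apply/rowP => j; rewrite !mxE; ring.
Qed.

Lemma solvableD n (a b a' b' : FF n) :
  solvable a b -> solvable a' b' -> solvable (a + a') (b + b').
Proof.
move=> [u [v [ru rv ea e0]]] [u' [v' [ru' rv' ea' e0']]].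
have sr := @submodule_range n.
exists (u + u'), (v + v'); split; try by apply: submodD.
  by rewrite -ea -ea' !scalerDr opprD addrACA.
by rewrite -e0 -e0' !scalerDr addrACA.
Qed.

(** Induction on [n] for right-hand sides [(z, 0)]. Swapping and adding then reach every [(a, b)],
    the form that the induction step consumes. *)
Lemma solvable_pow2 n (a b : FF n) :
  cwise (ideal_pow m 2) a -> cwise (ideal_pow m 2) b -> solvable a b.
Proof.
suff H (z : FF n) : cwise (ideal_pow m 2) z -> solvable z 0.
  move=> a2 b2; rewrite -[a]addr0 -[b]add0r; apply: solvableD; first exact: H.
  by apply: solvable_swap; apply: H.
elim: n {a b} z => [|n IH] z /cwise_pow2[s ->].
  (* The syzygy in [F_0] is all of [m F_0], so [(u0 + T v0) s] is available. *)
  exists (u0 *: s), (v0 *: s); rewrite range_diff0; split.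
  - by move=> j; rewrite mxE; apply: (ideal_mulr _ im).
  - by move=> j; rewrite mxE; apply: (ideal_mulr _ im).
  - by rewrite !scalerA -scalerBl uv1.
  - by rewrite !scalerA -scalerDl uv0 scale0r.
have mds : cwise m (d n s) by apply: range_diff_m; exists s.
have Hn (a b : FF n) : cwise (ideal_pow m 2) a -> cwise (ideal_pow m 2) b -> solvable a b.
  move=> a2 b2; rewrite -[a]addr0 -[b]add0r; apply: solvableD; first exact: IH.
  by apply: solvable_swap; apply: IH.
have [_ [_ [[C _ <-] [C' _ <-] e1 e2]]] :=
  Hn _ _ (smul_m_cwise mu0 mds) (smul_m_cwise mv0 mds).
(* This is [(u0 + T v0) s - (T x + y) (C + T C')]. The choice of [C] and [C'] makes it a cycle, and
   multiplying by [T x + y], of square zero, leaves [w s]. *)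
exists (u0 *: s - (y *: C - (c * x) *: C')), (v0 *: s - (x *: C + y *: C')); split.
- by apply: fr_diff_ker; rewrite linearB linearZ /= -e1 linearB !linearZ subrr.
- by apply: fr_diff_ker; rewrite linearB linearZ /= -e2 linearD !linearZ subrr.
- apply/rowP => j; rewrite !mxE -uv1.
  transitivity (((y * u0 - c * x * v0) * s 0 j - (y * y - c * (x * x)) * C 0 j
    + (c + c) * (x * y) * C' 0 j)); first by ring.
  by rewrite yyE xy0 subrr mulr0 !mul0r subr0 addr0.
- apply/rowP => j; rewrite !mxE.
  transitivity ((x * u0 + y * v0) * s 0 j - (x * y + x * y) * C 0 j
    - (y * y - c * (x * x)) * C' 0 j); first by ring.
  by rewrite uv0 xy0 yyE subrr addr0 !mul0r !subr0.
Qed.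

Lemma linear_at_pair n : linear_at n.
Proof.
move=> z z2; have [|u [v [ru rv <- _]]] := solvable_pow2 z2 (b := 0).
  by apply: submod0; apply: cwise_submodule; apply: ideal_powP.
apply: (submodB (submodule_smul _ _)); first exact: mem_smul.
by apply: mem_smul => //; apply: (ideal_mull _ im).
Qed.

End Pair.

Lemma linear_at_isotropic y u n : isotropic_pair m w y u -> linear_at n.
Proof.
move=> [my mu yy yu].
by apply: (@linear_at_pair 0 y 0 u 0);
  rewrite ?mulr0 ?mul0r ?addr0 ?subr0 ?yy //; apply: ideal0 im.
Qed.

Lemma linear_at_orthogonal x y c n : orthogonal_pair m pi x y c -> linear_at n.
Proof.
move=> [mx my xx xy [yy c0]].
have [c' cc] := local_unit hR hm3 c0.
have [a aw] := w_multiple hR hm3 pow2E (mem_ideal_pow2 im mx mx) xx.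
(* The partner is a multiple of [x], so that [y] kills it, scaled by [c' = 1 / c] and by [a] with
   [a * (x * x) = w]. *)
have mv : m (- (c' * a) * x) by apply: (ideal_mull _ im).
apply: (@linear_at_pair x y c 0 (- (c' * a) * x)) => //; first exact: ideal0 im.
  by rewrite -aw -[RHS]mul1r -cc; ring.
rewrite mulr0 add0r; transitivity (- (c' * a) * (x * y)); first by ring.
by rewrite xy mulr0.
Qed.

(** Lift 1 to [u] in [F_0] and write [x u = d f]. Linearity would give [x^2 f = x a] with [a] a
    syzygy; as [a] is [x G] up to the annihilator, [f] and [G] agree modulo [m] and [x d G = 0].
    Hence [x^2 u = 0], which forces [u] into [m F_0] although it augments to 1. *)
Lemma rank_one_not_linear x : rank_one m x -> ~ linear_at 1.
Proof.
move=> [mx xx xgen] lin.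
have x2_ann a : a * (x * x) = 0 -> m a.
  move=> axx; apply/(local_ker hR)/eqP/negP => /negP/(local_unit hR hm3)[b ba].
  by apply: xx; rewrite -[LHS]mul1r -ba -mulrA axx mulr0.
have [u _ augu] : range (fr_aug F) (1 : k) by rewrite fr_aug_surj.
have : range (d 0%N) (x *: u).
  apply: fr_aug_ker; rewrite linearZ; apply: etrans (scale_restr _ _) _.
  by move/(local_ker hR): mx => ->; rewrite mul0r.
move=> [f _ fE].
(* The syzygy lies in [m F_1], so each [t] in [m] acts on it as a multiple of [x], and [m] times the
   syzygy is [x] times it. *)
have [a ra xa] : [set x *: a | a in range (d 1%N)] ((x * x) *: f).
  have : cwise (ideal_pow m 2) ((x * x) *: f).
    move=> j; rewrite mxE mulrC; apply: (ideal_mull _ (ideal_powP _ _)).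
    by apply: mem_ideal_pow2 => //; exact: im.
  move=> /lin; apply: smul_sub => [|t a mt ra].
    have sr := @submodule_range 1.
    apply/submoduleP; split; first by exists 0; [exact: submod0|rewrite scaler0].
    move=> b _ _ [u1 ru1 <-] [v1 rv1 <-]; exists (b *: u1 + v1).
      by apply: submodD => //; apply: submodZ.
    by rewrite scalerDr !scalerA mulrC.
  have [s ann_s] := xgen t mt; exists (s *: a).
    exact: submodZ (@submodule_range 1) ra.
  have ma := range_diff_m ra.
  apply/rowP => j; rewrite !mxE; apply/eqP; rewrite -subr_eq0; apply/eqP.
  transitivity (- (a 0 j * (t - s * x))); first by ring.
  by rewrite ann_s // oppr0.
have ma := range_diff_m ra.
have /choice[g gP] : forall j, exists s, annihilator m (a 0 j - s * x).
  by move=> j; apply: xgen.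
pose G := \row_j g j.
have annG : cwise (annihilator m) (a - x *: G).
  by move=> j; rewrite !mxE [x * _]mulrC; apply: gP.
have mfG : cwise m (f - G).
  move=> j; apply: x2_ann.
  have := congr1 (fun v : FF 1 => v 0 j) xa; rewrite !mxE => e.
  transitivity (x * x * f 0 j - x * (g j * x)); first by ring.
  by rewrite -e -mulrBr gP.
have dann : d 0%N (a - x *: G) = 0.
  rewrite (rV_basisE (a - x *: G)) linear_sum big1 // => j _; rewrite linearZ.
  have md : cwise m (d 0%N (delta_mx 0 j)) by apply: range_diff_m; exists (delta_mx 0 j).
  by apply/rowP => i; rewrite [LHS]mxE [RHS]mxE mulrC; apply: annG.
have xdG : x *: d 0%N G = 0.
  have da : d 0%N a = 0 by case: ra => b _ <-; apply: fr_diff_diff.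
  by move: dann; rewrite linearB linearZ /= da sub0r => /eqP; rewrite oppr_eq0 => /eqP.
(* In [x d f = x d (f - G) + x d G] the first term lies in [m^3 F_0], and the second is zero by
   [xdG]. *)
have xxu : (x * x) *: u = 0.
  rewrite -scalerA -fE -(subrK G f) linearD scalerDr xdG addr0.
  apply: (smul_m_pow2 mx); rewrite (rV_basisE (f - G)) linear_sum.
  apply: submod_sum => [|j]; first by apply: cwise_submodule; apply: ideal_powP.
  rewrite linearZ; apply: smul_m_cwise; first exact: mfG.
  by apply: range_diff_m; exists (delta_mx 0 j).
have : fr_aug F u = 0.
  apply: linear_restr0; first exact: linearP.
  move=> j; apply/(local_ker hR); apply: x2_ann.
  by have := congr1 (fun v : FF 0 => v 0 j) xxu; rewrite !mxE mulrC.
by rewrite augu => /eqP; rewrite oner_eq0.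
Qed.

End Resolution.

(** * Koszulness and linearity of the minimal resolution *)

Section Koszul.
Variables (R : comNzRingType) (m : set R) (k : fieldType).
Variable pi : {rmorphism R -> k}.
Hypothesis hR : local_ring m pi.
Hypothesis hm3 : ideal_pow m 3 = [set 0].

Local Notation im := (local_ideal hR).

Lemma minimal_minimal_resolution (F : free_resolution (restr pi)) :
  minimal_resolution m F <-> minimal pi F.
Proof.
rewrite /minimal_resolution /fr_mod; split=> minF n x.
  by move=> xr; apply/(cwise_m hR); rewrite -(smul_cwise _ im); apply: minF xr.
by move=> xr; rewrite (smul_cwise _ im); apply/(cwise_m hR); apply: minF xr.
Qed.

Lemma mpow0 (V : lmodType R) (x : V) : mpow m 0 x.
Proof. by rewrite -[x]scale1r; apply: mem_smul. Qed.

Lemma mpowS_residue j (x : restr pi) : mpow m j.+1 x -> x = 0.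
Proof.
move: x; apply: (smul_sub (@submodule_set0 R (restr pi))) => a y pa _.
have : m a.
  elim: j pa => [|j IH]; first by rewrite ideal_pow1 //; exact: im.
  by move/ideal_pow_decr.
by move/(local_ker hR) => a0; apply: etrans (scale_restr _ _) _; rewrite a0 mul0r.
Qed.

Lemma mpow1 n : mpow m 1 = cwise m (n:=n).
Proof. by rewrite mpow_cwise ideal_pow1 //; exact: im. Qed.

Lemma mpow_ge3 n j (x : 'rV[R]_n) : (3 <= j)%N -> mpow m j x -> x = 0.
Proof.
move=> le3j; rewrite mpow_cwise ideal_pow_ge3 // => x0.
by apply/rowP => i; rewrite mxE x0.
Qed.

Lemma submodule_mpow (V : lmodType R) j : submodule (@mpow R m V j).
Proof. exact: submodule_smul. Qed.

Lemma mpow_zero (V : lmodType R) j : mpow m j (0 : V).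
Proof. exact: submod0 (submodule_mpow V j). Qed.

Variable F : free_resolution (restr pi).
Hypothesis minF : minimal pi F.

Local Notation d n := (fr_diff F n).

Lemma mpow_range n x : range (d n) x -> mpow m 1 x.
Proof. by rewrite mpow1; apply: (range_diff_m hR minF). Qed.

Lemma aug_mpow1 x : mpow m 1 x -> fr_aug F x = 0.
Proof.
rewrite mpow1 => /(cwise_m hR) x0.
by apply: linear_restr0 x0; apply: linearP.
Qed.

(* Acyclicity of lin(F) at F_(n+1), with i = j - n - 1. *)
Lemma linear_exactS n i : (forall n, linear_at m F n) ->
  subquo_exact (d n.+1 : fr_mod F n.+2 -> fr_mod F n.+1) (d n : _ -> fr_mod F n)
    (mpow m (i - 1)) (mpow m i) (mpow m i.+1) (mpow m i.+2).
Proof.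
move=> lin; apply/seteqP; split=> x [xi].
  (* For [i = 0], linearity matches [d x] with the image of an element of [m F], up to a cycle,
     itself in [m F]. For [i = 1], [d x] lies in [m^3 F_n = 0]. For [i = 2], linearity applies to
     [x] itself, and beyond that [x = 0]. *)
  case: i xi => [|[|[|i]]] xi dx; split=> //.
  - have [x' mx' dx'] : (d n @` cwise m (n:=_)) (d n x).
      by rewrite -(smul_range hR); apply: lin; rewrite -mpow_cwise.
    exists 0; first exact: mpow0.
    rewrite linear0 subr0 -(subrK x' x).
    apply: (submodD (submodule_mpow _ 1)); last by rewrite mpow1.
    by apply: mpow_range; apply: fr_diff_ker; rewrite linearB dx' subrr.
  - have /fr_diff_ker[y _ <-] := mpow_ge3 (leqnn 3) dx.
    exists y; first exact: mpow0.
    by rewrite subrr; apply: mpow_zero.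
  - have : (d n.+1 @` cwise m (n:=_)) x.
      by rewrite -(smul_range hR); apply: lin; rewrite -mpow_cwise.
    move=> [y my <-]; exists y; first by rewrite mpow1.
    by rewrite subrr; apply: mpow_zero.
  - exists 0; first by apply: mpow_zero.
    by rewrite (mpow_ge3 _ xi) // linear0 subrr; apply: mpow_zero.
move=> [y yi xy]; split=> //.
have sm V j := @submodule_mpow V j.
have -> : d n x = d n (x - d n.+1 y) by rewrite linearB fr_diff_diff subr0.
rewrite mpow_cwise in xy; rewrite mpow_cwise.
exact: (diff_cwise_pow hR minF).
Qed.

Lemma linear_koszul : (forall n, linear_at m F n) -> koszul_ring m pi.
Proof.
move=> lin; exists F; split=> [|j]; first exact/minimal_minimal_resolution.
split.
- apply/seteqP; split=> x [xj]; last by [].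
  move=> _; split=> //; case: j xj => [|j] xj.
    have [y _ <-] : range (fr_aug F) x by rewrite fr_aug_surj.
    exists y; first exact: mpow0.
    by rewrite subrr; apply: mpow_zero.
  rewrite (mpowS_residue xj); exists 0; first by apply: mpow_zero.
  by rewrite linear0 subrr; apply: mpow_zero.
- apply/seteqP; split=> x [xj]; last first.
    move=> [y yj xy]; split=> //.
    have -> : fr_aug F x = 0.
      rewrite -(subrK (d 0%N y) x) linearD /= fr_aug_diff addr0.
      apply: aug_mpow1; elim: j {xj yj} xy => [//|j IH] xy.
      by apply: IH; move: xy; rewrite !mpow_cwise => h i; apply: ideal_pow_decr.
    by apply: mpow_zero.
  move=> /mpowS_residue/fr_aug_ker[y _ yx].
  split=> //; case: j xj => [|[|[|j]]] xj.
  + exists y; first exact: mpow0.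
    by rewrite yx subrr; apply: mpow_zero.
  + exists y; first exact: mpow0.
    by rewrite yx subrr; apply: mpow_zero.
  + have : (d 0%N @` cwise m (n:=_)) x.
      by rewrite -(smul_range hR); apply: lin; rewrite -mpow_cwise.
    move=> [z mz <-]; exists z; first by rewrite mpow1.
    by rewrite subrr; apply: mpow_zero.
  + exists 0; first by apply: mpow_zero.
    by rewrite (mpow_ge3 _ xj) // linear0 subrr; apply: mpow_zero.
(* When [j < n.+1] the quotient at [F_(n+1)] is zero; what remains to check is that [d n] lands in
   [m F_n], which matters for [n = j]. *)
move=> n; have [le_nj|lt_jn] := leqP n.+1 j.
  have := linear_exactS n (j - n.+1) lin.
  have -> : (j - n.+1 - 1 = j - n.+2)%N by rewrite -subnDA addn1.
  have -> : ((j - n.+1).+2 = j.+1 - n)%N by rewrite -(subSn le_nj) subSS subSn // ltnW.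
  by rewrite (subSn le_nj).
have e1 : (j - n.+1 = 0)%N by apply/eqP; rewrite subn_eq0 ltnW.
have e2 : (j - n.+2 = 0)%N by apply/eqP; rewrite subn_eq0 ltnW // ltnW.
have e3 : (j.+1 - n.+1 = 0)%N by apply/eqP; rewrite subn_eq0.
rewrite e1 e2 e3; apply/seteqP; split=> x _; split; try exact: mpow0.
  by exists 0; apply: mpow0.
move: lt_jn; rewrite ltnS leq_eqVlt => /orP[/eqP->|].
  by rewrite subSn // subnn; apply: mpow_range; exists x.
by rewrite -subn_eq0 => /eqP->; apply: mpow0.
Qed.

(** Exactness of [lin_3] at [F_1]: elements of [m^2 F_1] are cycles because [m^3 = 0], and they
    equal, modulo [m^3 F_1 = 0], boundaries from [m F_2]. *)
Lemma koszul_linear1 : (forall j, lin_acyclic m F j) -> linear_at m F 1.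
Proof.
move=> lin x x2; have [_ _ /(_ 0%N)] := lin 3%N; rewrite /subquo_exact predeqE.
move=> /(_ x)[+ _] => -[|_ [y ym]].
  split; first by rewrite mpow_cwise.
  rewrite mpow_cwise => j.
  by have -> := diff_pow2_eq0 hR hm3 minF x2; rewrite mxE; apply: ideal0 (ideal_powP _ _).
move=> /(mpow_ge3 (leqnn 3))/subr0_eq ->; rewrite (smul_range hR).
by exists y => //; rewrite -mpow1.
Qed.

End Koszul.

(** * Rank counts along the minimal resolution *)

Section Counting.
Variables (R : comNzRingType) (m : set R) (k : fieldType).
Variable pi : {rmorphism R -> k}.
Hypothesis hR : local_ring m pi.
Hypothesis hm3 : ideal_pow m 3 = [set 0].
Variable w : R.
Hypothesis pow2E : ideal_pow m 2 = range (fun a => a * w).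
Hypothesis w_ann : forall a, a * w = 0 -> m a.
Variable F : free_resolution (restr pi).
Hypothesis minF : minimal pi F.

Local Notation im := (local_ideal hR).
Local Notation d n := (fr_diff F n).
Local Notation r n := (fr_rank F n).
Local Notation e := (rank (V := R^o) pi m (ideal_pow m 2)).
Local Notation surj := (local_surj hR).
Local Notation unit := (local_unit hR hm3).

Let sm2 n : submodule (cwise (ideal_pow m 2) (n:=n)).
Proof. by apply: cwise_submodule; apply: ideal_powP. Qed.

(** The kernel of [d n] lies in [m F_(n+1)] by minimality, so [d n] identifies [F_(n+1) / m F_(n+1)]
    with the syzygy modulo [m] times it. *)
Lemma fbasis_syzygy n :
  exists (T : finType) (v : T -> _),
    fbasis pi (range (d n)) (ideal_smul m (range (d n))) v /\ #|T| = r n.+1.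
Proof.
have b1 : fbasis (V := R^o) pi setT m (fun _ : 'I_1 => 1).
  split=> // [a _|c].
    by exists (fun=> a); rewrite big_ord1 /= [_ *: _]mulr1 subrr; apply: ideal0 im.
  by rewrite big_ord1 [_ *: _]mulr1 => /(local_ker hR) c0 i; rewrite [i]ord1.
have := fbasis_cwise (r n.+1) (@submoduleT R R^o) im b1.
have -> : @cwise R setT (r n.+1) = setT by apply/seteqP; split.
move=> b2; exists ('I_1 * 'I_(r n.+1))%type; eexists; split; last first.
  by rewrite card_prod !card_ord mul1n.
apply: (fbasis_img (f := d n) erefl _ (@submoduleT R _) b2).
apply/seteqP; split=> x; last first.
  rewrite (smul_range hR) => -[_ [x' mx' dx']].
  rewrite -(subrK x' x); apply: (submodD (cwise_submodule _ im)) => //.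
  by apply: (range_diff_m hR minF); apply: fr_diff_ker; rewrite linearB dx' subrr.
by move=> mx; split=> //; rewrite (smul_range hR); exists x.
Qed.

Lemma m_layer n a (x : 'rV[R]_n) :
  pi a = 0 -> cwise m x -> cwise (ideal_pow m 2) (a *: x).
Proof. by move=> /(local_ker hR); apply: (smul_m_cwise hR). Qed.

Lemma fbasis_layer1 n : exists (T : finType) (v : T -> 'rV[R]_n),
  fbasis pi (cwise m (n:=n)) (cwise (ideal_pow m 2) (n:=n)) v /\ #|T| = (e * n)%N.
Proof.
have i2 := @ideal_powP R m 2.
have [p [v vb]] := fbasis_R (local_noetherian hR) unit im i2.
have := rank_fbasis surj i2 _ vb; rewrite card_ord => ->; last first.
  by move=> a x /(local_ker hR) ma mx; apply: mem_ideal_pow2 => //; exact: im.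
have vb' := fbasis_cwise n im i2 vb.
by exists ('I_p * 'I_n)%type; eexists; split; [exact: vb'|rewrite card_prod !card_ord].
Qed.

Lemma fbasis_layer2 n : exists (T : finType) (v : T -> 'rV[R]_n),
  fbasis pi (cwise (ideal_pow m 2) (n:=n)) [set 0] v /\ #|T| = n.
Proof.
have wb : fbasis (V := R^o) pi (ideal_pow m 2) [set 0] (fun _ : 'I_1 => w).
  split=> [_|x|c /=]; first exact: pow2_w pow2E.
    by rewrite pow2E => -[a _ <-]; exists (fun=> a); rewrite big_ord1 /= subrr.
  by rewrite big_ord1 => /w_ann/(local_ker hR) c0 i; rewrite [i]ord1.
have := fbasis_cwise n (@ideal_powP R m 2) (@submodule_set0 R R^o) wb.
have -> : @cwise R [set 0] n = [set 0].
  by apply/seteqP; split=> [x x0|x -> j];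
    [apply/rowP => j; rewrite mxE; apply: x0|rewrite mxE].
move=> b; exists ('I_1 * 'I_n)%type; eexists; split; first exact: b.
by rewrite card_prod !card_ord mul1n.
Qed.

Lemma rank_res0 : r 0 = 1%N.
Proof.
have b1 : fbasis (V := R^o) pi setT m (fun _ : 'I_1 => 1).
  split=> // [a _|c].
    by exists (fun=> a); rewrite big_ord1 /= [_ *: _]mulr1 subrr; apply: ideal0 im.
  by rewrite big_ord1 [_ *: _]mulr1 => /(local_ker hR) c0 i; rewrite [i]ord1.
have := fbasis_cwise (r 0) (@submoduleT R R^o) im b1.
have -> : @cwise R setT (r 0) = setT by apply/seteqP; split.
move=> /(fbasis_img (f := fr_aug F) (A := setT) (B := [set 0])) b2.
have bk : fbasis (V := restr pi) pi setT [set 0] (fun _ : 'I_1 => (1 : k)).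
  split=> // [x _|c].
    have [a ax] := surj x; exists (fun=> a); rewrite big_ord1.
    by apply/eqP; rewrite subr_eq0 -ax eq_sym; apply/eqP; apply: mulr1.
  by rewrite big_ord1 => /= h i; rewrite [i]ord1 -h [RHS]mulr1.
have := fbasis_card surj (@submodule_set0 R (restr pi)) _ bk (b2 _ _ _).
rewrite card_prod !card_ord mul1n; apply.
- by move=> a x a0 _; apply: etrans (scale_restr _ _) _; rewrite a0 mul0r.
- by rewrite fr_aug_surj.
- apply/seteqP; split=> x; first move=> + /=.
    by rewrite -(mpow1 hR) => h; split=> //; apply: (aug_mpow1 hR h).
  by move=> [_] /fr_aug_ker; apply: range_diff_m.
- exact: submoduleT.
Qed.

(* Rank-nullity for m F_(n+1) / m^2 F_(n+1) -> m^2 F_n, which is onto. *)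
Lemma fbasis_range_layer n : linear_at m F n ->
  exists (q : nat) (v : 'I_q -> _),
    fbasis pi (range (d n.+1)) (cwise (ideal_pow m 2) (n:=_)) v /\
    (r n + q = e * r n.+1)%N.
Proof.
move=> lin; have sr := submodule_range F.
(* With [Om = range (d n.+1)], [q] is the rank of [Om / m^2 F_(n+1)] and [t] below that of
   [m F_(n+1) / Om]. Since [d n] maps the latter onto [m^2 F_n], [t] equals [r n]. *)
have [q [v vb]] := fbasis_rV (local_noetherian hR) unit (sr n.+1) (sm2 _).
have [t [u ub]] := fbasis_rV (local_noetherian hR) unit (cwise_submodule _ im) (sr n.+1).
exists q, v; split=> //.
have [T [u2 [b2 <-]]] := fbasis_layer1 (r n.+1).
have p2r : cwise (ideal_pow m 2) (n:=_) `<=` range (d n.+1).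
  by move=> x x2; apply: fr_diff_ker; apply: (diff_pow2_eq0 hR hm3 minF x2).
have b := fbasis_cat (sr n.+1) (sm2 _) (range_diff_m hR minF (n := n.+1)) p2r
  (@m_layer _) ub vb.
have := fbasis_card surj (sm2 _) (@m_layer _) b2 b.
rewrite card_sum !card_ord => <-; congr (_ + _)%N.
have [T2 [u3 [b3 {1}<-]]] := fbasis_layer2 (r n).
have b' : fbasis pi (cwise (ideal_pow m 2) (n:=_)) [set 0] (d n \o u).
  apply: fbasis_img (cwise_submodule _ im) ub.
    apply/seteqP; split=> x; first by move/lin; rewrite (smul_range hR).
    by rewrite -(smul_range hR); apply: (smul_range_sub hR minF).
  apply/seteqP; split=> x.
    move=> xr; split; first exact: (range_diff_m hR minF xr).
    by case: xr => y _ <-; apply: fr_diff_diff.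
  by move=> [_ /=]; apply: fr_diff_ker.
rewrite (fbasis_card surj (@submodule_set0 R _) _ b' b3) ?card_ord //.
by move=> a x /(local_ker hR) ma; apply: (smul_m_pow2 hm3 ma).
Qed.

Lemma rank_res1 : r 1 = e.
Proof.
have [T [v [vb <-]]] := fbasis_syzygy 0.
have [S [u [ub]]] := fbasis_layer1 (r 0); rewrite rank_res0 muln1 => <-.
have e2 : ideal_smul m (range (d 0%N)) = cwise (ideal_pow m 2) (n:=_).
  by apply/seteqP; split; [apply: (smul_range_sub hR minF)|apply: (linear_at0 hR minF)].
move: vb; rewrite e2 (range_diff0 hR minF) => vb.
exact: (fbasis_card surj (sm2 _) (@m_layer _) ub vb).
Qed.

(** Linearity at [n.+1] makes the quotient of rank [q] in [fbasis_range_layer] the syzygy modulo [m]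
    times it, so [q] is [r n.+2]. *)
Lemma rank_res_rec n : linear_at m F n -> linear_at m F n.+1 ->
  (r n + r n.+2 = e * r n.+1)%N.
Proof.
move=> lin lin1; have [q [v [vb <-]]] := fbasis_range_layer lin.
have [T [u [ub <-]]] := fbasis_syzygy n.+1.
move: ub; have -> : ideal_smul m (range (d n.+1)) = cwise (ideal_pow m 2) (n:=_).
  by apply/seteqP; split; [apply: (smul_range_sub hR minF)|].
move=> ub; rewrite (fbasis_card surj (sm2 _) _ vb ub) ?card_ord //.
move=> a x a0 xr; apply: m_layer => //; exact: (range_diff_m hR minF xr).
Qed.

(** Write [Om] for the syzygy in [F_(n+1)]. The rank [r n.+2] of [Om / m Om] is [q] plus the rank
    [p] of [m^2 F_(n+1) / m Om]; the equality of ranks forces [p = 0]. *)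
Lemma linear_at_of_rank n : linear_at m F n ->
  (r n + r n.+2 = e * r n.+1)%N -> linear_at m F n.+1.
Proof.
move=> lin rr; have [q [v [vb]]] := fbasis_range_layer lin.
rewrite -rr => /addnI qr.
have [T [u [ub uT]]] := fbasis_syzygy n.+1.
have ss := @submodule_smul R 'rV[R]_(r n.+1) m (range (d n.+1)).
have [p [t tb]] := fbasis_rV (local_noetherian hR) unit (sm2 _) ss.
have ms a x : pi a = 0 -> range (d n.+1) x -> ideal_smul m (range (d n.+1)) (a *: x).
  by move=> /(local_ker hR) ma; apply: mem_smul.
have p2r : cwise (ideal_pow m 2) (n:=_) `<=` range (d n.+1).
  by move=> x x2; apply: fr_diff_ker; apply: (diff_pow2_eq0 hR hm3 minF x2).
have b := fbasis_cat (sm2 _) ss p2r (smul_range_sub hR minF (n := n.+1)) ms vb tb.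
have := fbasis_card surj ss ms ub b.
rewrite card_sum !card_ord uT qr -[RHS]addn0 => /addnI p0.
case: tb => _ tgen _; clear b; move: t tgen; rewrite p0 => t tgen x x2.
by have [c] := tgen x x2; rewrite big_ord0 subr0.
Qed.

End Counting.

(** * Inflations *)

Lemma linear_pack (R : comNzRingType) (U V : lmodType R) (f : U -> V) :
  linear f -> exists g : {linear U -> V}, f = g.
Proof.
move=> fL; exists (HB.pack_for {linear U -> V} f (GRing.isLinear.Build R _ _ _ f fL)).
by [].
Qed.

Lemma linear_linear_combination (R : comNzRingType) (U V : lmodType R) (f : U -> V)
    (T : Type) (s : seq T) (c : T -> R) (u : T -> U) : linear f ->
  f (\sum_(t <- s) c t *: u t) = \sum_(t <- s) c t *: f (u t).
Proof.
move=> /linear_pack[g ->]; rewrite linear_sum.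
by apply: eq_bigr => t _; rewrite linearZ.
Qed.

(** A finite dual basis suffices: a tensor is recovered from its contractions by the [co i], which
    live in [N], where injectivity of [f] applies. *)
Lemma flat_free (R : comNzRingType) (M : lmodType R) n (t : 'I_n -> M)
    (co : 'I_n -> M -> R^o) :
  (forall i, linear (co i)) -> (forall x, x = \sum_i co i x *: t i) -> flat M.
Proof.
move=> coL tE N N' f finj s hs P B [Bl Br].
have co0 i : \sum_(p <- s) co i p.1 *: p.2 = 0.
  apply: finj; rewrite linear0 linear_sum.
  have h := hs N' (fun x y => co i x *: y); rewrite big_map in h.
  apply: etrans (h _); first by apply: eq_bigr => p _; rewrite linearZ.
  split=> [x|y] a u v.
    by rewrite scalerDr !scalerA mulrC.
  by rewrite (coL i) scalerDl scalerA.
transitivity (\sum_i B (t i) (\sum_(p <- s) co i p.1 *: p.2)).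
  rewrite [RHS](eq_bigr (fun i => \sum_(p <- s) co i p.1 *: B (t i) p.2)); last first.
    by move=> i _; rewrite linear_linear_combination.
  rewrite exchange_big; apply: eq_bigr => p _.
  by rewrite {1}(tE p.1) (linear_linear_combination _ _ _ (Br p.2)).
rewrite big1 // => i _; rewrite co0.
by have [g ->] := linear_pack (Bl (t i)); rewrite linear0.
Qed.

(** * Obstruction to Conca generators in inflations *)

Section Descent.
Variables (R : comNzRingType) (m : set R) (k : fieldType).
Variable pi : {rmorphism R -> k}.
Hypothesis hR : local_ring m pi.
Hypothesis hm3 : ideal_pow m 3 = [set 0].
Variables (R' : comNzRingType) (m' : set R') (k' : fieldType).
Variables (pi' : {rmorphism R' -> k'}) (phi : {rmorphism R -> R'}).
Hypothesis hR' : local_ring m' pi'.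
Hypothesis infl : inflation m m' phi.

Lemma inflation_sub a : m a -> m' (phi a).
Proof. by case: infl => _ -> ma; apply: sub_gen_smallest; exists a. Qed.

(* The embedding of k in R with image w R stays injective after tensoring with R'. *)
Lemma inflation_socle_neq0 w : (forall a, a * w = 0 <-> m a) -> phi w <> 0.
Proof.
(* [l] is only a set-theoretic section of [pi], but [c |-> l c * w] is linear because [m] kills
   [w]. *)
move=> wE phiw; have /choice[l lP] := local_surj hR.
have lm a : m a -> a * w = 0 by move/wE.
have fL : linear ((fun c => l c * w) : restr pi -> R^o).
  move=> a c d; rewrite [_ *: (_ : R^o)]mulrA -mulrDl; apply/eqP.
  rewrite -subr_eq0 -mulrBl; apply/eqP/lm/(local_ker hR).
  by rewrite rmorphB rmorphD rmorphM !lP; apply: subrr.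
have [f fE] := linear_pack fL.
have {}fE c : f c = l c * w by rewrite -fE.
have finj : injective f.
  move=> c d /eqP; rewrite -subr_eq0 !fE -mulrBl => /eqP/wE.
  by move/(local_ker hR); rewrite rmorphB !lP => /eqP; rewrite subr_eq0 => /eqP.
case: infl => /(_ _ _ f finj [:: ((1 : R') : restr phi, (1 : k) : restr pi)]) + _.
have psiE a b : pi a = pi b -> pi' (phi a) = pi' (phi b).
  move=> ab; apply/eqP; rewrite -subr_eq0 -!rmorphB; apply/eqP.
  apply/(local_ker hR')/inflation_sub/(local_ker hR).
  by rewrite rmorphB ab subrr.
move=> flatE; suff /flatE :
    tensor_eq0 [seq (p.1, f p.2) | p <- [:: ((1 : R') : restr phi, (1 : k) : restr pi)]].
  (* This bilinear map into [k'] sends [(1, 1)] to 1, so the tensor of 1 with 1 is nonzero. *)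
  move=> /(_ (restr (pi' \o phi)) (fun a c => pi' a * pi' (phi (l c)))).
  rewrite big_seq1 /= rmorph1 mul1r (psiE _ 1) ?lP ?rmorph1 // => h.
  have /eqP : (1 : k') = 0.
    apply: h; split=> [a r c d|c r a b].
      rewrite (psiE _ (r * l c + l d)); last first.
        by rewrite rmorphD rmorphM !lP.
      by rewrite !rmorphD !rmorphM mulrDr mulrCA.
    change (pi' (phi r * a + b) * pi' (phi (l c)) =
      pi' (phi r) * (pi' a * pi' (phi (l c))) + pi' b * pi' (phi (l c))).
    by rewrite rmorphD rmorphM mulrDl mulrA.
  by rewrite oner_eq0.
(* Moving the scalar across the tensor turns 1 with [l 1 * w] into [phi (l 1 * w)] with 1, which
   vanishes with [phi w]. *)
move=> P B [Bl Br].
rewrite big_seq1 /= fE; have [g gE] := linear_pack (Bl 1).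
have [h hE] := linear_pack (Br 1).
transitivity (g (l 1 * w *: (1 : R^o))); first by rewrite gE [_ *: 1]mulr1.
rewrite linearZ -gE /=.
transitivity (h (l 1 * w *: ((1 : R') : restr phi))); first by rewrite linearZ /= -hE.
have -> : l 1 * w *: ((1 : R') : restr phi) = 0.
  by apply: etrans (mulr1 _) _; rewrite rmorphM phiw mulr0.
by rewrite linear0.
Qed.

(** The decomposition of [m] passes to [m'], so [z] is [r * phi x] up to the annihilator, and
    [z^2 = 0] gives [r^2 phi (x^2) = 0]. If [r] lies in [m'] then [z m' = 0], against [phi (x^2)]
    being a nonzero element of [z m']; otherwise [r] is invertible modulo [m'] and [phi (x^2) = 0].
    Flatness excludes both. *)
Lemma rank_one_not_conca x z : rank_one m x -> ~ conca_generator m' z.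
Proof.
move=> [mx xx xgen] [mz z0 zz zm].
have im' := local_ideal hR'.
have m'E : m' = ideal_span (phi @` m) by case: infl.
have xxE a : a * (x * x) = 0 <-> m a.
  split=> [axx|ma]; last exact: (mul3_eq0 hR hm3).
  apply/(local_ker hR)/eqP/negP => /negP/(local_unit hR hm3)[b ba].
  by apply: xx; rewrite -[LHS]mul1r -ba -mulrA axx mulr0.
have phix := inflation_socle_neq0 xxE.
have ann_span y : (forall t, m t -> y * phi t = 0) -> annihilator m' y.
  move=> yt t; rewrite m'E; apply: (@ideal_span_sub _ _ [set t | t * y = 0]).
    apply/idealP; split=> [|a u v /= u0 v0]; first by rewrite /= mul0r.
    by rewrite mulrDl -mulrA u0 v0 mulr0 addr0.
  by move=> _ [s ms <-] /=; rewrite mulrC yt.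
have decomp y : m' y -> exists r, annihilator m' (y - r * phi x).
  rewrite {1}m'E; move: y; apply: ideal_span_sub.
    apply/idealP; split=> [|a u v [r ur] [s vs]].
      by exists 0; rewrite mul0r subr0; apply: ideal0 (annihilatorP _).
    exists (a * r + s).
    have -> : a * u + v - (a * r + s) * phi x =
        a * (u - r * phi x) + (v - s * phi x) by ring.
    by apply: (idealD (annihilatorP _)) => //; apply: (ideal_mull _ (annihilatorP _)).
  move=> _ [s ms <-]; have [c cE] := xgen s ms; exists (phi c).
  by apply: ann_span => t mt; rewrite -rmorphM -rmorphB -rmorphM mulrC cE // rmorph0.
have [r rz] := decomp z mz.
have mphix := inflation_sub mx.
have annxx : annihilator m' (phi (x * x)).
  by apply: ann_span => t mt; rewrite -rmorphM mulrC (mul3_eq0 hR hm3) ?rmorph0.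
have zr : r * r * phi (x * x) = 0.
  rewrite rmorphM.
  transitivity (z ^+ 2 - z * (z - r * phi x) - r * (phi x * (z - r * phi x))).
    by ring.
  by rewrite zz rz // rz // mulr0 !subr0.
have [/(local_ker hR') mr|/eqP r0] := pselect (pi' r = 0).
  have zt t : m' t -> z * t = 0.
    move=> mt; have [q tq] := decomp t mt.
    transitivity (t * (z - r * phi x) + r * (phi x * (t - q * phi x))
      + q * (r * phi (x * x))).
      by rewrite rmorphM; ring.
    by rewrite rz // tq // annxx // !mulr0 !addr0.
  have : ideal_pow m' 2 (phi (x * x)) by rewrite rmorphM; apply: mem_ideal_pow2.
  by rewrite -zm => -[y my zy]; apply: phix; rewrite -zy zt.
have [q qr] := local_surj hR' (pi' r)^-1.
have mt : m' (1 - q * r).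
  by apply/(local_ker hR'); rewrite rmorphB rmorphM rmorph1 qr mulVf // subrr.
apply: phix.
(* Since [1 = (1 + q r) (1 - q r) + q^2 r^2], both summands kill [phi (x * x)]. *)
transitivity ((1 + q * r) * ((1 - q * r) * phi (x * x)) + q * q * (r * r * phi (x * x))).
  by ring.
by rewrite zr annxx // !mulr0 addr0.
Qed.

End Descent.

(* A[T] / (T^2 + c), where (a, b) stands for a + b T. *)
Definition quad_ext (A : comNzRingType) (c : A) : Type := (A * A)%type.

(** * Quadratic extensions and the inflation they give *)

Section QuadExt.
Variables (A : comNzRingType) (c : A).
Local Notation Q := (quad_ext c).

HB.instance Definition _ := GRing.Zmodule.on Q.

Definition quad_one : Q := (1, 0).
Definition quad_mul (x y : Q) : Q :=
  (x.1 * y.1 - c * x.2 * y.2, x.1 * y.2 + x.2 * y.1).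

Fact quad_mulA : associative quad_mul.
Proof. by move=> x y z; congr pair; rewrite /=; ring. Qed.
Fact quad_mulC : commutative quad_mul.
Proof. by move=> x y; congr pair; rewrite /=; ring. Qed.
Fact quad_mul1 : left_id quad_one quad_mul.
Proof. by case=> a b; congr pair; rewrite /=; ring. Qed.
Fact quad_mulDl : left_distributive quad_mul +%R.
Proof. by move=> x y z; congr pair; rewrite /=; ring. Qed.
Fact quad_one_neq0 : quad_one != 0.
Proof. by apply/eqP => -[/eqP]; rewrite oner_eq0. Qed.

HB.instance Definition _ := GRing.Zmodule_isComNzRing.Build Q
  quad_mulA quad_mulC quad_mul1 quad_mulDl quad_one_neq0.

Lemma quad_mulE (x y : Q) :
  x * y = (x.1 * y.1 - c * x.2 * y.2, x.1 * y.2 + x.2 * y.1) :> Q.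
Proof. by []. Qed.

Definition quad_in (a : A) : Q := (a, 0).

Fact quad_in_additive : zmod_morphism quad_in.
Proof. by move=> a b; congr pair; rewrite /= subr0. Qed.
Fact quad_in_multiplicative : monoid_morphism quad_in.
Proof. by split=> // a b; congr pair; rewrite /=; ring. Qed.

HB.instance Definition _ := GRing.isZmodMorphism.Build A Q quad_in quad_in_additive.
HB.instance Definition _ := GRing.isMonoidMorphism.Build A Q quad_in
  quad_in_multiplicative.

End QuadExt.

Section QuadField.
Variables (k : fieldType) (c : k) (hc : forall t, t * t + c != 0).

(** The proof [h] is part of the type, so that the field structure depending on it can be attached
    to this copy of [quad_ext c]. *)
Definition quad_field (h : forall t, t * t + c != 0) : Type := quad_ext c.
Local Notation K := (quad_field hc).

HB.instance Definition _ := GRing.ComNzRing.on K.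

(** The conjugate [a - b T] divided by the norm [a^2 + c b^2]. *)
Definition quad_inv (x : K) : K :=
  let n := x.1 * x.1 + c * (x.2 * x.2) in (x.1 / n, - x.2 / n).

Fact quad_mulVf (x : K) : x != 0 -> quad_inv x * x = 1.
Proof.
case: x => a b x0; have n0 : a * a + c * (b * b) != 0.
  have [b0|b0] := eqVneq b 0.
    rewrite b0 !mulr0 addr0 mulf_neq0 //;
    by apply: contraNneq x0 => a0; rewrite a0 b0.
  have -> : a * a + c * (b * b) = (b * b) * (a / b * (a / b) + c) by field.
  by rewrite mulf_neq0 // mulf_neq0.
by congr pair; rewrite /=; field.
Qed.

Fact quad_inv0 : quad_inv 0 = 0.
Proof. by congr pair; rewrite /= ?oppr0 mul0r. Qed.

HB.instance Definition _ := GRing.ComNzRing_isField.Build K quad_mulVf quad_inv0.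

End QuadField.

Section QuadMap.
Variables (R : comNzRingType) (k : fieldType) (pi : {rmorphism R -> k}) (c : R).
Variable hc : forall t, t * t + pi c != 0.

Definition quad_map (x : quad_ext c) : quad_field hc := (pi x.1, pi x.2).

Fact quad_map_additive : zmod_morphism quad_map.
Proof. by move=> x y; congr pair; rewrite /= rmorphB. Qed.
Fact quad_map_multiplicative : monoid_morphism quad_map.
Proof.
split=> [|x y]; first by congr pair; rewrite /= ?rmorph1 ?rmorph0.
by congr pair; rewrite /= ?rmorphB ?rmorphD !rmorphM.
Qed.

HB.instance Definition _ := GRing.isZmodMorphism.Build (quad_ext c) (quad_field hc)
  quad_map quad_map_additive.
HB.instance Definition _ := GRing.isMonoidMorphism.Build (quad_ext c) (quad_field hc)
  quad_map quad_map_multiplicative.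

End QuadMap.

(** Elements of the kernel have cube zero, so anything outside it is a unit by a geometric series,
    and the kernel is the only maximal ideal. *)
Lemma local_ring_nil (S : comNzRingType) (K : fieldType) (p : {rmorphism S -> K}) :
  noetherian S -> (forall y, exists x, p x = y) ->
  (forall t, p t = 0 -> t * (t * t) = 0) -> local_ring [set x | p x = 0] p.
Proof.
move=> noethS psurj nil.
have iM : ideal [set x | p x = 0].
  apply/idealP; split=> [|a u v /= u0 v0]; first by rewrite /= rmorph0.
  by rewrite rmorphD rmorphM u0 v0 mulr0 addr0.
have big (I : set S) x : ideal I -> I x -> p x <> 0 -> I = setT.
  move=> iI Ix px; have [y yx] := psurj (p x)^-1.
  have := nil (1 - y * x); rewrite rmorphB rmorphM rmorph1 yx mulVf; last exact/eqP.
  rewrite subrr => /(_ erefl) t0.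
  have I1 : I 1.
    have -> : 1 = (y + (1 - y * x) * y + (1 - y * x) * (1 - y * x) * y) * x
        + (1 - y * x) * ((1 - y * x) * (1 - y * x)) by ring.
    by rewrite t0 addr0; apply: (ideal_mull _ iI).
  by apply/seteqP; split=> // z _; rewrite -[z]mulr1; apply: (ideal_mull _ iI).
have MT : [set x | p x = 0] <> setT.
  by rewrite predeqE => /(_ 1)[_ /(_ I)] /= /eqP; rewrite rmorph1 oner_eq0.
have maxM : maximal_ideal [set x | p x = 0].
  split=> // I iI MI; have [IM|] := pselect (I `<=` [set x | p x = 0]).
    by left; apply/seteqP; split.
  by move=> /existsNP[x /not_implyP[Ix px]]; right; apply: big iI Ix px.
split=> //; last by apply/seteqP; split=> // y _; have [x <-] := psurj y; exists x.
move=> J [iJ JT Jmax]; have [JM|] := pselect (J `<=` [set x | p x = 0]).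
  by case: (Jmax _ iM JM).
by move=> /existsNP[x /not_implyP[Jx px]]; case: JT; apply: big iJ Jx px.
Qed.

Lemma conca_isotropic (R : comNzRingType) (m : set R) (k : fieldType)
    (pi : {rmorphism R -> k}) (w : R) (y u : R) : local_ring m pi ->
  ideal_pow m 2 = range (fun a => a * w) -> w <> 0 ->
  isotropic_pair m w y u -> conca_generator m y.
Proof.
move=> hR pow2E w0 [my mu yy yu]; have im := local_ideal hR.
split=> //; first by apply/eqP => y0; apply: w0; rewrite -yu y0 mul0r.
apply/seteqP; split=> [_ [t mt <-]|x]; first exact: mem_ideal_pow2.
rewrite pow2E => -[a _ <-]; exists (a * u); first exact: ideal_mull.
by rewrite -yu mulrCA.
Qed.

Lemma inflation_id (R : comNzRingType) (m : set R) : ideal m ->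
  inflation m m (idfun : {rmorphism R -> R}).
Proof.
move=> im; split; last first.
  rewrite image_id; apply/seteqP; split; first exact: sub_gen_smallest.
  exact: ideal_span_sub.
apply: (@flat_free _ _ 1 (fun=> (1 : R) : restr _) (fun _ x => x)) => [_ a x y //|x].
by rewrite big_ord1; apply: esym; apply: mulr1.
Qed.

Section QuadInflation.
Variables (R : comNzRingType) (m : set R) (k : fieldType).
Variable pi : {rmorphism R -> k}.
Hypothesis hR : local_ring m pi.
Hypothesis hm3 : ideal_pow m 3 = [set 0].
Variables (c : R) (hc : forall t, t * t + pi c != 0).

Local Notation Q := (quad_ext c).
Local Notation phi := (@quad_in R c).
Local Notation im := (local_ideal hR).

Definition quad_max : set Q := [set z | quad_map hc z = 0].

Lemma quad_maxP z : quad_max z <-> m z.1 /\ m z.2.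
Proof.
split=> [[z1 z2]|[/(local_ker hR) z1 /(local_ker hR) z2]].
  by split; apply/(local_ker hR).
by rewrite /quad_max /= /quad_map z1 z2.
Qed.

(** An ideal of [Q] is in particular an [R]-submodule of [R^2], hence finitely generated already
    over [R]. *)
Lemma quad_noetherian : noetherian Q.
Proof.
move=> J iJ.
pose toQ (x : 'rV[R]_2) : Q := (x 0 0, x 0 1).
have toQZ a x : toQ (a *: x) = phi a * toQ x by congr pair; rewrite /= !mxE; ring.
have toQD x y : toQ (x + y) = toQ x + toQ y by congr pair; rewrite /= !mxE.
have [|p [g [gJ gen]]] := @noetherian_rV R 2 [set x | J (toQ x)] (local_noetherian hR).
  apply/submoduleP; split.
    by rewrite /= (_ : toQ 0 = 0); [apply: ideal0 iJ|congr pair; rewrite mxE].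
  move=> a u v /= Ju Jv; rewrite toQD toQZ.
  by apply: (idealD iJ) => //; apply: (ideal_mull _ iJ).
exists p, (toQ \o g); apply/seteqP; split; last first.
  by apply: ideal_span_sub => // _ [i _ <-]; apply: gJ.
move=> z Jz; pose x : 'rV[R]_2 := \row_j (if j == 0 then z.1 else z.2).
have zE : z = toQ x by rewrite /toQ !mxE /=; case: (z).
rewrite zE in Jz *; have [d ->] := gen x Jz; rewrite ideal_span_range.
exists (fun i => phi (d i)) => //.
rewrite (big_morph toQ toQD (_ : toQ 0 = 0)); last by congr pair; rewrite mxE.
by apply: eq_bigr => i _; rewrite toQZ.
Qed.

Lemma quad_local : local_ring quad_max (quad_map hc).
Proof.
apply: local_ring_nil; first exact: quad_noetherian.
  case=> a b; have [x xa] := local_surj hR a; have [y yb] := local_surj hR b.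
  by exists (x, y); rewrite /= /quad_map /= xa yb.
move=> t /quad_maxP[m1 m2].
have m0 := mul3_eq0 hR hm3.
rewrite !quad_mulE; congr pair; rewrite /=.
  transitivity (t.1 * (t.1 * t.1) - (c + c + c) * (t.1 * (t.2 * t.2))); first by ring.
  by rewrite (m0 t.1 t.1) // (m0 t.1 t.2) // mulr0 subr0.
transitivity ((1 + 1 + 1) * (t.1 * (t.1 * t.2)) - c * (t.2 * (t.2 * t.2))); first by ring.
by rewrite (m0 t.1 t.1) // (m0 t.2 t.2) // !mulr0 subr0.
Qed.

Lemma quad_inflation : inflation m quad_max phi.
Proof.
split; last first.
  apply/seteqP; split; last first.
    apply: (@ideal_span_sub Q); first exact: (local_ideal quad_local).
    by move=> _ [a ma <-]; apply/quad_maxP; split=> //; apply: ideal0 im.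
  move=> z /quad_maxP[m1 m2].
  have -> : z = phi z.1 + ((0, 1) : Q) * phi z.2.
    by case: z {m1 m2} => a b; rewrite quad_mulE; congr pair; rewrite /=; ring.
  apply: (idealD (ideal_spanP _)); last apply: (ideal_mull _ (ideal_spanP _)).
    by apply: sub_gen_smallest; exists z.1.
  by apply: sub_gen_smallest; exists z.2.
apply: (@flat_free _ _ 2 (fun i => (if i == 0 then (1, 0) else (0, 1)) : restr phi)
  (fun i x => if i == 0 then (x : Q).1 else (x : Q).2)).
  move=> i a x y; case: ifP => _.
    by change (a * x.1 - c * 0 * x.2 + y.1 = a * x.1 + y.1); ring.
  by change (a * x.2 + 0 * x.1 + y.2 = a * x.2 + y.2); ring.
move=> x; rewrite big_ord_recl big_ord1 /=.
change (x = phi x.1 * ((1, 0) : Q) + phi x.2 * ((0, 1) : Q) :> Q).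
by rewrite !quad_mulE; case: x => a b; congr pair; rewrite /=; ring.
Qed.

Lemma quad_conca w x y : ideal_pow m 2 = range (fun a => a * w) ->
  orthogonal_pair m pi x y c ->
  conca_generator quad_max ((y, x) : Q).
Proof.
move=> pow2E [mx my xx xy [yy c0]].
have lQ := local_ideal quad_local.
have mz : quad_max ((y, x) : Q) by apply/quad_maxP.
split=> //.
- by apply/eqP => -[_ x0]; apply: xx; rewrite x0 mul0r.
- rewrite expr2 quad_mulE /= yy [y * x]mulrC xy addr0; congr pair.
  by rewrite -mulrA subrr.
apply/seteqP; split=> [_ [t mt <-]|]; first exact: mem_ideal_pow2.
have iz : ideal [set ((y, x) : Q) * t | t in quad_max].
  apply/idealP; split; first by exists 0; [apply: ideal0 lQ|rewrite mulr0].
  move=> a _ _ [s ms <-] [t mt <-]; exists (a * s + t); last by ring.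
  by apply: (idealD lQ) => //; apply: (ideal_mull _ lQ).
apply: (ideal_pow2_sub lQ iz) => a b /quad_maxP[ma1 ma2] /quad_maxP[mb1 mb2].
have [d dc] := local_unit hR hm3 c0.
have sq u v := sqr_multiple hR hm3 pow2E mx xx (y := u) (z := v).
have [a11 e11] := sq _ _ ma1 mb1; have [a22 e22] := sq _ _ ma2 mb2.
have [a12 e12] := sq _ _ ma1 mb2; have [a21 e21] := sq _ _ ma2 mb1.
(* As [x y = 0], the generator times [phi x] is [T x^2]. Times [p + T q] this is
   [- c q x^2 + T p x^2]; comparing with [a * b] gives [p = a12 + a21] and
   [c q = c a22 * c - c a11 * 1] up to the unit factor, that is [q = - d (a11 - c a22)] with
   [d * c = 1]. *)
exists (phi x * ((a12 + a21, - (d * (a11 - c * a22))) : Q)).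
  apply: (ideal_mulr _ lQ); apply/quad_maxP; split=> //; exact: ideal0 im.
rewrite !quad_mulE -[c * a.2 * b.2]mulrA e11 e12 e21 e22; congr pair; rewrite /=.
  transitivity (d * c * (a11 - c * a22) * (x * x) + (x * y) * (a12 + a21)); first by ring.
  by rewrite dc xy; ring.
transitivity ((a12 + a21) * (x * x) - (x * y) * (d * (a11 - c * a22))); first by ring.
by rewrite xy; ring.
Qed.

End QuadInflation.

Lemma conca_exists (R : comNzRingType) (m : set R) (k : fieldType)
    (pi : {rmorphism R -> k}) (w : R) : local_ring m pi ->
  ideal_pow m 3 = [set 0] -> ideal_pow m 2 = range (fun a => a * w) -> w <> 0 ->
  (exists y u, isotropic_pair m w y u) \/ (exists x y c, orthogonal_pair m pi x y c) ->
  exists (R' : comNzRingType) (m' : set R') (k' : fieldType)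
    (pi' : {rmorphism R' -> k'}) (phi : {rmorphism R -> R'}),
    [/\ local_ring m' pi', inflation m m' phi & exists x : R', conca_generator m' x].
Proof.
move=> hR hm3 pow2E w0; have im := local_ideal hR.
have iso y u : isotropic_pair m w y u ->
  exists (R' : comNzRingType) (m' : set R') (k' : fieldType)
    (pi' : {rmorphism R' -> k'}) (phi : {rmorphism R -> R'}),
    [/\ local_ring m' pi', inflation m m' phi & exists x : R', conca_generator m' x].
  move=> yu; exists R, m, k, pi, idfun; split=> //; first exact: inflation_id.
  by exists y; apply: (conca_isotropic hR pow2E w0 yu).
case=> [[y [u yu]]|[x [y [c xyc]]]]; first exact: iso yu.
have [mx my xx xy [yy c0]] := xyc.
have [[t tc]|nsq] := pselect (exists t, t * t + pi c = 0); last first.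
  have hc t : t * t + pi c != 0 by apply/eqP => tc; apply: nsq; exists t.
  exists (quad_ext c), (quad_max hc), (quad_field hc), (quad_map hc), (@quad_in R c).
  split; [exact: (quad_local hR hm3 hc)|exact: (quad_inflation hR hm3 hc)|].
  by exists (y, x); apply: (quad_conca hR hm3 hc pow2E xyc).
have [s st] := local_surj hR t.
have s0 : pi s != 0.
  by apply: contraNneq c0 => s0; rewrite -tc -st s0 mulr0 add0r.
have [s' ss] := local_unit hR hm3 s0.
have [b bw] := w_multiple hR hm3 pow2E (mem_ideal_pow2 im mx mx) xx.
(* Here [s] lifts a square root [t] of [- pi c], so [s * s + c] lies in [m] and the square
   [(s * s + c) * (x * x)] lies in [m^3]. *)
apply: (iso (s * x + y) (b * s' * x)); split.
- by apply: (idealD im) => //; apply: (ideal_mull _ im).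
- by apply: (ideal_mull _ im).
- transitivity ((s * s + c) * (x * x) + (s + s) * (x * y)); first by ring: yy.
  rewrite xy mulr0 addr0; apply: (mul3_eq0 hR hm3) => //; apply/(local_ker hR).
  by rewrite rmorphD rmorphM st.
- transitivity (b * (s' * s) * (x * x) + b * s' * (x * y)); first by ring.
  by rewrite xy ss mulr1 mulr0 addr0.
Qed.

(** * The power series identity and the equivalences *)

Lemma fps_mul_quadratic (A : comNzRingType) (a : A) (f : nat -> A) :
  fps_mul f (fps_of_poly (1 - a *: 'X + 'X^2)) = fps_of_poly 1 <->
  [/\ f 0%N = 1, f 1%N = a & forall n, f n.+2 = a * f n.+1 - f n].
Proof.
have gE j : (1 - a *: 'X + 'X^2 : {poly A})`_j =
    (j == 0%N)%:R - a * (j == 1%N)%:R + (j == 2%N)%:R.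
  by rewrite !coefE.
have E0 : fps_mul f (fps_of_poly (1 - a *: 'X + 'X^2)) 0 = f 0%N.
  by rewrite /fps_mul /fps_of_poly big_ord1 gE /=; ring.
have E1 : fps_mul f (fps_of_poly (1 - a *: 'X + 'X^2)) 1 = f 1%N - a * f 0%N.
  by rewrite /fps_mul /fps_of_poly big_ord_recr big_ord1 /= !gE /=; ring.
have ES n : fps_mul f (fps_of_poly (1 - a *: 'X + 'X^2)) n.+2 =
    f n.+2 - a * f n.+1 + f n.
  rewrite /fps_mul /fps_of_poly !big_ord_recr big1 /= => [|i _].
    have -> : (n.+2 - n = 2)%N by lia.
    have -> : (n.+2 - n.+1 = 1)%N by lia.
    by rewrite subnn !gE /=; ring.
  have [j ->] : exists j, (n.+2 - i)%N = j.+3.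
    by exists (n.-1 - i)%N; have := ltn_ord i; lia.
  by rewrite gE /=; ring.
split=> [e|[f0 f1 fS]].
  have f0 : f 0%N = 1 by rewrite -E0 e /fps_of_poly coef1.
  have f1 : f 1%N - a * f 0%N = 0 by rewrite -E1 e /fps_of_poly coef1.
  split=> [//||n]; first by move/subr0_eq: f1; rewrite f0 mulr1.
  have := ES n; rewrite e /fps_of_poly coef1 /= => h.
  transitivity (f n.+2 - a * f n.+1 + f n + (a * f n.+1 - f n)); first by ring.
  by rewrite -h; ring.
apply/funext => -[|[|n]]; rewrite ?E0 ?E1 ?ES /fps_of_poly coef1 /=.
- exact: f0.
- by rewrite f0 f1 mulr1 subrr.
- by rewrite fS; ring.
Qed.

Theorem theorem4p1 (R : comNzRingType) (m : set R) (k : fieldType)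
    (pi : {rmorphism R -> k}) (hR : local_ring m pi)
    (hm3 : ideal_pow m 3 = [set 0])
    (hm2 : rank (V := R^o) pi (ideal_pow m 2) [set 0] = 1%N)
    (e s : nat)
    (he : e = rank (V := R^o) pi m (ideal_pow m 2))
    (hs : s = rank (V := R^o) pi (annihilator m) [set 0])
    (b : nat -> int) (hb0 : b 0%N = 1) (hb1 : b 1%N = e%:Z)
    (hb : forall n : nat, (1 <= n)%N -> b n.+1 = e%:Z * b n - b n.-1) :
  [<-> exists (R' : comNzRingType) (m' : set R') (k' : fieldType)
         (pi' : {rmorphism R' -> k'}) (phi : {rmorphism R -> R'}),
         [/\ local_ring m' pi', inflation m m' phi &
             exists x : R', conca_generator m' x];
       koszul_ring m pi;
       fps_mul (poincare pi (restr pi))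
         (fps_of_poly (1 - e%:Z *: 'X + 'X^2)) = fps_of_poly 1;
       forall n : nat, (betti pi (restr pi) n)%:Z = b n;
       s%:Z <= e%:Z - 1].
Proof.
have [w [pow2E w_ann]] := socle_generator hR hm2.
have [pairs rk1] := rank_one_or hR hm3 pow2E w_ann he hs.
have [F minF] := minimal_resolution_exists (local_noetherian hR) (local_surj hR)
  (local_unit hR hm3).
have bettiE n : betti pi (restr pi) n = fr_rank F n.
  by apply: betti_minimal => //; apply: local_surj hR.
have lin : (s < e)%N -> forall n, linear_at m F n.
  move=> /pairs[[y [u yu]]|[x [y [c xyc]]]] n.
    exact: (linear_at_isotropic hR pow2E minF yu).
  exact: (linear_at_orthogonal hR hm3 pow2E minF xyc).
have not_rk1 : (forall x, ~ rank_one m x) -> (s < e)%N.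
  by move=> h; rewrite ltnNge; apply/negP => /rk1[x /h].
tfae.
- move=> [R' [m' [k' [pi' [phi [hR' infl [z zc]]]]]]].
  apply: (linear_koszul hR hm3 minF); apply: lin; apply: not_rk1 => x rx.
  exact: (rank_one_not_conca hR hm3 hR' infl rx zc).
- move=> [G [/(minimal_minimal_resolution hR) minG linG]].
  (* The resolution [G] witnessing Koszulness rules out [rank_one], and this gives linearity of the
     fixed resolution [F]. *)
  have {}lin : forall n, linear_at m F n.
    apply: lin; apply: not_rk1 => x rx.
    exact: (rank_one_not_linear hR hm3 minG rx (koszul_linear1 hR hm3 minG linG)).
  apply/fps_mul_quadratic; rewrite /poincare !bettiE; split.
  + by rewrite (rank_res0 hR minF).
  + by rewrite (rank_res1 hR hm3 minF) -he.
  + move=> n; rewrite !bettiE.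
    have := rank_res_rec hR hm3 pow2E w_ann minF (lin n) (lin n.+1).
    by rewrite -he => /(congr1 Posz); rewrite PoszD PoszM => <-; ring.
- move=> /fps_mul_quadratic[f0 f1 fS] n.
  (* The recurrence has order two, so two consecutive values are carried through the induction. *)
  suff [] : (betti pi (restr pi) n)%:Z = b n /\
      (betti pi (restr pi) n.+1)%:Z = b n.+1 by [].
  elim: n => [|n [IH IH1]]; first by rewrite hb0 hb1.
  by split=> //; rewrite hb //= -IH -IH1; apply: fS.
- move=> bE; suff : (s < e)%N by lia.
  apply: not_rk1 => x rx.
  apply: (rank_one_not_linear hR hm3 minF rx).
  apply: (linear_at_of_rank hR hm3 pow2E w_ann minF (linear_at0 hR minF)).
  (* The value [b 2 = e^2 - 1] is the rank equality that yields linearity at 1. *)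
  have := hb 1%N erefl; rewrite /= hb1 hb0 -bE bettiE => b2.
  rewrite (rank_res0 hR minF) (rank_res1 hR hm3 minF) -he.
  by apply/eqP; rewrite -eqz_nat PoszD PoszM b2; apply/eqP; ring.
- move=> se; apply: (conca_exists hR hm3 pow2E (w_neq0 hR w_ann)).
  by apply: pairs; lia.
Qed.
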